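(* Let $R$ be a noetherian ring of finite dimension, $X=\operatorname{Spec} R$, and suppose that $R$ contains a field of characteristic zero. Then $$\Gamma(X_{\mathrm{surj}},\mathcal O_{\mathrm{surj}})=\Gamma(X_{\mathrm{cons}},\mathcal O_{\mathrm{cons}}),$$ (the identification being given by the natural homomorphism $\Gamma(X_{\mathrm{cons}},\mathcal O_{\mathrm{cons}})\to\Gamma(X_{\mathrm{surj}},\mathcal O_{\mathrm{surj}})$ coming from the fact that the surjective topology is a refinement of the constructible topology).
   Context: Rings are commutative. Surjective topology $X_{\mathrm{surj}}$: the category is the full subcategory of schemes (or schemes of finite type) affine over $X$; the coverings are the single affine surjective morphisms $V\to U$ of finite type over $X$. A constructible partition of a scheme $X$ is a finite disjoint union $X=\biguplus_{i\in I}X_i$ where each $X_i\to X$ factors as an open embedding $X_i\to W_i$ followed by a closed embedding $W_i\to X$. Constructible topology $X_{\mathrm{cons}}$: the category is the full subcategory of schemes of finite type which are affine over $X$; a single morphism $U\to V$ is a cover if there is a constructible partition $\biguplus_{i\in I}V_i\to V$ and a factorization $\biguplus_{i\in I}V_i\to U\to V$. $\mathcal O_{\mathrm{surj}}$ and $\mathcal O_{\mathrm{cons}}$ denote the sheafifications, in the respective topology, of the presheaf $\operatorname{Spec} S\mapsto S$. *)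

(* Defs.v *)
From HB Require Import structures.
From mathcomp Require Import all_boot all_algebra.

Set Implicit Arguments.
Unset Strict Implicit.
Unset Printing Implicit Defensive.

Import GRing.Theory.
Local Open Scope ring_scope.

(* Rings are commutative and may be zero (comPzRingType): the category of
   affine schemes must contain the empty scheme.  This is also why MathComp's
   comAlgType and prime_idealr, which exclude the zero ring, are not used.
   Ideals are Prop-valued, so that no decidability is imposed on them. *)

Definition is_ideal (A : comPzRingType) (I : A -> Prop) : Prop :=
  [/\ I 0, forall x y, I x -> I y -> I (x + y) & forall a x, I x -> I (a * x)].

Definition is_prime (A : comPzRingType) (p : A -> Prop) : Prop :=
  [/\ is_ideal p, ~ p 1 & forall x y, p (x * y) -> p x \/ p y].

Definition ideal_gen (A : comPzRingType) (s : seq A) (x : A) : Prop :=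
  forall I : A -> Prop, is_ideal I -> (forall y, y \in s -> I y) -> I x.

Definition noetherian (A : comPzRingType) : Prop :=
  forall I : A -> Prop, is_ideal I ->
    exists s : seq A, forall x, I x <-> ideal_gen s x.

Definition proper_incl (A : comPzRingType) (p q : A -> Prop) : Prop :=
  (forall x, p x -> q x) /\ (exists x, q x /\ ~ p x).

Definition finite_dimension (A : comPzRingType) : Prop :=
  exists d : nat, forall (n : nat) (p : nat -> A -> Prop),
    (forall i, (i <= n)%N -> is_prime (p i)) ->
    (forall i, (i < n)%N -> proper_incl (p i) (p i.+1)) ->
    (n <= d)%N.

Definition contains_char0_field (A : comPzRingType) : Prop :=
  exists (K : fieldType) (i : {rmorphism K -> A}),
    injective i /\ [pchar K] =i pred0.

(* Schemes of finite type and affine over Spec R are represented by their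
   rings of functions: such a scheme is Spec S for a finitely generated
   R-algebra S, and a morphism Spec T -> Spec S over Spec R is a morphism
   S -> T of R-algebras. *)

Definition finitely_generated (R A : comPzRingType) (i : R -> A) : Prop :=
  exists s : seq A, forall P : A -> Prop,
    (forall r, P (i r)) -> (forall x, x \in s -> P x) ->
    (forall x y, P x -> P y -> P (x + y)) ->
    (forall x y, P x -> P y -> P (x * y)) ->
    forall x, P x.

Record falg (R : comPzRingType) := FAlg {
  falg_ring :> comPzRingType;
  falg_str : {rmorphism R -> falg_ring};
  falg_fg : finitely_generated falg_str }.

Record falg_hom (R : comPzRingType) (S T : falg R) := FAlgHom {
  hom_fun :> {rmorphism S -> T};
  hom_str : forall r : R, hom_fun (falg_str S r) = falg_str T r }.

Fact falg_id_str (R : comPzRingType) (S : falg R) (r : R) :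
  (idfun : {rmorphism S -> S}) (falg_str S r) = falg_str S r.
Proof. by []. Qed.

Definition falg_id (R : comPzRingType) (S : falg R) : falg_hom S S :=
  FAlgHom (@falg_id_str R S).

Fact falg_comp_str (R : comPzRingType) (S T U : falg R)
  (g : falg_hom T U) (f : falg_hom S T) (r : R) :
  (g \o f : {rmorphism S -> U}) (falg_str S r) = falg_str U r.
Proof. by rewrite /= !hom_str. Qed.

Definition falg_comp (R : comPzRingType) (S T U : falg R)
  (g : falg_hom T U) (f : falg_hom S T) : falg_hom S U :=
  FAlgHom (falg_comp_str g f).

Fact falg_base_fg (R : comPzRingType) :
  finitely_generated (idfun : {rmorphism R -> R}).
Proof. by exists [::] => P Pi _ _ _ x; exact: Pi. Qed.

(* The terminal object Spec R of the category of schemes. *)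
Definition falg_base (R : comPzRingType) : falg R := FAlg (@falg_base_fg R).

(* Presheaves of rings on schemes are covariant functors of R-algebras. *)
Record presheaf (R : comPzRingType) := Presheaf {
  sec :> falg R -> comPzRingType;
  res : forall S T : falg R, falg_hom S T -> {rmorphism sec S -> sec T};
  res_ext : forall (S T : falg R) (f g : falg_hom S T),
    f =1 g -> res f =1 res g;
  res_id : forall (S : falg R) (x : sec S), res (falg_id S) x = x;
  res_comp : forall (S T U : falg R) (g : falg_hom T U) (f : falg_hom S T)
    (x : sec S), res (falg_comp g f) x = res g (res f x) }.

Record presheaf_hom (R : comPzRingType) (F G : presheaf R) := PresheafHom {
  phom :> forall S : falg R, {rmorphism F S -> G S};
  phom_nat : forall (S T : falg R) (f : falg_hom S T) (x : F S),
    phom T (res F f x) = res G f (phom S x) }.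

(* The presheaf Spec S |-> S. *)
Definition structure_presheaf (R : comPzRingType) : presheaf R :=
  @Presheaf R (fun S => S) (fun S T f => f) (fun S T f g e => e)
    (fun S x => erefl) (fun S T U g f x => erefl).

(* All topologies considered are given by coverings Spec T -> Spec S
   consisting of a single morphism. *)
Definition coverage (R : comPzRingType) :=
  forall S T : falg R, falg_hom S T -> Prop.

(* The condition that the two restrictions of x to the fibre product of
   Spec T with itself over Spec S agree is tested on all pairs of morphisms
   Spec W -> Spec T with the same composite to Spec S. *)
Definition matching (R : comPzRingType) (F : presheaf R) (S T : falg R)
    (f : falg_hom S T) (x : F T) : Prop :=
  forall (W : falg R) (a b : falg_hom T W),
    (forall s : S, a (f s) = b (f s)) -> res F a x = res F b x.

Definition is_sheaf (R : comPzRingType) (cov : coverage R) (F : presheaf R) :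
    Prop :=
  forall (S T : falg R) (f : falg_hom S T), cov _ _ f ->
    forall x : F T, matching f x -> exists! y : F S, res F f y = x.

Definition factors_through (R : comPzRingType) (P F G : presheaf R)
    (eta : presheaf_hom P F) (g : presheaf_hom P G) (phi : presheaf_hom F G) :
    Prop :=
  forall (S : falg R) (x : P S), phi S (eta S x) = g S x.

Definition unique_factorization (R : comPzRingType) (P F G : presheaf R)
    (eta : presheaf_hom P F) (g : presheaf_hom P G) (phi : presheaf_hom F G) :
    Prop :=
  factors_through eta g phi /\
  forall psi : presheaf_hom F G, factors_through eta g psi ->
    forall S : falg R, psi S =1 phi S.

Definition is_sheafification (R : comPzRingType) (cov : coverage R)
    (P F : presheaf R) (eta : presheaf_hom P F) : Prop :=
  is_sheaf cov F /\
  forall (G : presheaf R) (g : presheaf_hom P G), is_sheaf cov G ->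
    exists phi : presheaf_hom F G, unique_factorization eta g phi.

Definition Spec_surjective (A B : comPzRingType) (f : A -> B) : Prop :=
  forall p : A -> Prop, is_prime p ->
    exists q : B -> Prop, is_prime q /\ forall a, p a <-> q (f a).

Definition surj_cov (R : comPzRingType) : coverage R :=
  fun S T f => Spec_surjective f.

(* A scheme Y with a morphism Y -> Spec A factoring as an open embedding
   Y -> W followed by a closed embedding W -> Spec A: the closed subscheme W
   is Spec lc_ring for a quotient lc_ring of A, and Y is the open subscheme
   of W whose points are the primes not containing the set lc_open.
   The scheme Y need not be affine. *)
Record loc_closed (A : comPzRingType) := LocClosed {
  lc_ring : comPzRingType;
  lc_map : {rmorphism A -> lc_ring};
  lc_surj : forall y : lc_ring, exists a : A, lc_map a = y;
  lc_open : lc_ring -> Prop }.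

Definition lc_point (A : comPzRingType) (Y : loc_closed A)
    (q : lc_ring Y -> Prop) : Prop :=
  is_prime q /\ exists e : lc_ring Y, lc_open e /\ ~ q e.

Definition in_image (A : comPzRingType) (Y : loc_closed A) (p : A -> Prop) :
    Prop :=
  exists q : lc_ring Y -> Prop, lc_point q /\ forall a, p a <-> q (lc_map Y a).

Definition constructible_partition (A : comPzRingType) (I : finType)
    (Y : I -> loc_closed A) : Prop :=
  forall p : A -> Prop, is_prime p -> exists! i : I, in_image (Y i) p.

(* A morphism Spec B -> W = Spec lc_ring factors, uniquely, through the open
   subscheme Y if and only if all its values are points of Y; these are the
   B-valued points of the scheme Y. *)
Definition lc_valued_point (A : comPzRingType) (Y : loc_closed A)
    (B : comPzRingType) (a : lc_ring Y -> B) : Prop :=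
  forall q : B -> Prop, is_prime q -> lc_point (fun y => q (a y)).

(* The embedding Y -> Spec A factors through f : Spec T -> Spec A.
   A morphism of schemes Y -> Spec T is given by its action on B-valued
   points, for all rings B, i.e. by a natural transformation from the functor
   of points of Y to that of Spec T.  In lc_lift_nat, a' is any morphism
   pointwise equal to c \o a, so that h depends only on the underlying
   function of a. *)
Record lc_lift (A T : comPzRingType) (f : A -> T) (Y : loc_closed A) := LcLift {
  lc_lift_fun : forall (B : comPzRingType) (a : {rmorphism lc_ring Y -> B}),
    lc_valued_point a -> {rmorphism T -> B};
  lc_lift_nat : forall (B C : comPzRingType) (c : {rmorphism B -> C})
    (a : {rmorphism lc_ring Y -> B}) (a' : {rmorphism lc_ring Y -> C})
    (ha : lc_valued_point a) (ha' : lc_valued_point a'),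
    (forall y, a' y = c (a y)) ->
    forall t : T, lc_lift_fun ha' t = c (lc_lift_fun ha t);
  lc_lift_over : forall (B : comPzRingType) (a : {rmorphism lc_ring Y -> B})
    (ha : lc_valued_point a) (x : A),
    lc_lift_fun ha (f x) = a (lc_map Y x) }.

Definition cons_cov (R : comPzRingType) : coverage R :=
  fun S T f => exists (I : finType) (Y : I -> loc_closed S),
    constructible_partition Y /\ forall i : I, inhabited (lc_lift f (Y i)).

(* Main.v *)
(** Both sheafifications are the presheaf F of constructible functions: terms in
    the elements of S and a total inverse x^-1 (with 0^-1 = 0), two terms being
    identified when they agree at all field-valued points of Spec S.

    In a constructible sheaf G under the structure presheaf, every b in S has a
    weak inverse y (b^2 y = b and b y^2 = y): it exists on the covering
    V(b) + D(b) of Spec S, and descends because weak inverses are unique.  So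
    terms can be evaluated in G, and the value depends only on the class in F,
    because a nilpotent element having a weak inverse is 0.  Hence F -> G.

    Constructible coverings are surjective, so it remains to see that F is a
    sheaf for the surjective topology.  Given Spec T -> Spec S and a matching x
    in F(T), let q lie over p; near q, x = t/u.  If t/u were not fractional over
    S/p, in characteristic 0 two morphisms from T to a field agreeing on S would
    separate it, against the matching condition.  So t/u = a/c with a, c in S,
    and since generic points of V(p) lift to Spec T with u invertible, x = a/c
    over a nonempty open subset of V(p).  Noetherian induction glues these
    fractions. *)

Require Import Defs.
From HB Require Import structures.
From mathcomp Require Import all_boot all_algebra all_field ring.
From mathcomp Require Import boolp classical_sets.

Set Implicit Arguments.
Unset Strict Implicit.
Unset Printing Implicit Defensive.

Import GRing.Theory.
Local Open Scope classical_set_scope.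
Local Open Scope quotient_scope.
Local Open Scope ring_scope.

(** * Quotient rings *)

(** A commutative ring whose laws hold only up to [pr_eqv]. Residue rings and rings of terms modulo
    identities both arise as its quotients, so the ring axioms are descended to classes once. *)
Record prering := Prering {
  pr_sort : Type;
  pr_eqv : pr_sort -> pr_sort -> Prop;
  pr_zero : pr_sort;
  pr_one : pr_sort;
  pr_opp : pr_sort -> pr_sort;
  pr_add : pr_sort -> pr_sort -> pr_sort;
  pr_mul : pr_sort -> pr_sort -> pr_sort;
  pr_refl : forall x, pr_eqv x x;
  pr_sym : forall x y, pr_eqv x y -> pr_eqv y x;
  pr_trans : forall x y z, pr_eqv x y -> pr_eqv y z -> pr_eqv x z;
  pr_oppE : forall x y, pr_eqv x y -> pr_eqv (pr_opp x) (pr_opp y);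
  pr_addE : forall x x' y y', pr_eqv x x' -> pr_eqv y y' ->
    pr_eqv (pr_add x y) (pr_add x' y');
  pr_mulE : forall x x' y y', pr_eqv x x' -> pr_eqv y y' ->
    pr_eqv (pr_mul x y) (pr_mul x' y');
  pr_addA : forall x y z,
    pr_eqv (pr_add x (pr_add y z)) (pr_add (pr_add x y) z);
  pr_addC : forall x y, pr_eqv (pr_add x y) (pr_add y x);
  pr_add0 : forall x, pr_eqv (pr_add pr_zero x) x;
  pr_addN : forall x, pr_eqv (pr_add (pr_opp x) x) pr_zero;
  pr_mulA : forall x y z,
    pr_eqv (pr_mul x (pr_mul y z)) (pr_mul (pr_mul x y) z);
  pr_mulC : forall x y, pr_eqv (pr_mul x y) (pr_mul y x);
  pr_mul1 : forall x, pr_eqv (pr_mul pr_one x) x;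
  pr_mulD : forall x y z,
    pr_eqv (pr_mul (pr_add x y) z) (pr_add (pr_mul x z) (pr_mul y z)) }.

Section PreringQuotient.
Variable P : prering.

Definition pr_choice : Type := pr_sort P.
HB.instance Definition _ := gen_eqMixin pr_choice.
HB.instance Definition _ := gen_choiceMixin pr_choice.

Definition pr_eqvb (x y : pr_choice) : bool := `[< pr_eqv x y >].

Fact pr_eqvb_refl : reflexive pr_eqvb.
Proof. by move=> x; apply/asboolP; exact: pr_refl. Qed.
Fact pr_eqvb_sym : symmetric pr_eqvb.
Proof. by move=> x y; apply/asboolP/asboolP; exact: pr_sym. Qed.
Fact pr_eqvb_trans : transitive pr_eqvb.
Proof.
by move=> y x z /asboolP xy /asboolP yz; apply/asboolP; exact: pr_trans xy yz.
Qed.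
Canonical pr_equiv := EquivRel pr_eqvb pr_eqvb_refl pr_eqvb_sym pr_eqvb_trans.

Definition prquot : Type := {eq_quot pr_equiv}.
HB.instance Definition _ := Choice.on prquot.

Definition pr_mk (x : pr_sort P) : prquot :=
  \pi_({eq_quot pr_equiv}) (x : pr_choice).
Definition pr_rep (x : prquot) : pr_sort P := repr (x : {eq_quot pr_equiv}).

Lemma pr_repK x : pr_mk (pr_rep x) = x.
Proof. exact: reprK. Qed.

Lemma pr_mkP x y : pr_mk x = pr_mk y <-> pr_eqv x y.
Proof.
split=> [/eqmodP /asboolP //|xy]; by apply/eqmodP/asboolP.
Qed.

Lemma pr_mk_ind (Q : prquot -> Prop) : (forall x, Q (pr_mk x)) -> forall x, Q x.
Proof. by move=> Qmk x; rewrite -(pr_repK x). Qed.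

Lemma pr_rep_mk x : pr_eqv (pr_rep (pr_mk x)) x.
Proof. by apply/pr_mkP; rewrite pr_repK. Qed.

Definition prq_zero := pr_mk (pr_zero P).
Definition prq_one := pr_mk (pr_one P).
Definition prq_opp x := pr_mk (pr_opp (pr_rep x)).
Definition prq_add x y := pr_mk (pr_add (pr_rep x) (pr_rep y)).
Definition prq_mul x y := pr_mk (pr_mul (pr_rep x) (pr_rep y)).

Lemma prq_oppE x : prq_opp (pr_mk x) = pr_mk (pr_opp x).
Proof. by apply/pr_mkP/pr_oppE/pr_rep_mk. Qed.
Lemma prq_addE x y : prq_add (pr_mk x) (pr_mk y) = pr_mk (pr_add x y).
Proof. by apply/pr_mkP/pr_addE; exact: pr_rep_mk. Qed.
Lemma prq_mulE x y : prq_mul (pr_mk x) (pr_mk y) = pr_mk (pr_mul x y).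
Proof. by apply/pr_mkP/pr_mulE; exact: pr_rep_mk. Qed.

Let prqE := (prq_oppE, prq_addE, prq_mulE).

Fact prq_addA : associative prq_add.
Proof.
elim/pr_mk_ind=> x; elim/pr_mk_ind=> y; elim/pr_mk_ind=> z.
by rewrite !prqE; apply/pr_mkP/pr_addA.
Qed.
Fact prq_addC : commutative prq_add.
Proof.
elim/pr_mk_ind=> x; elim/pr_mk_ind=> y.
by rewrite !prqE; apply/pr_mkP/pr_addC.
Qed.
Fact prq_add0 : left_id prq_zero prq_add.
Proof. by elim/pr_mk_ind=> x; rewrite !prqE; apply/pr_mkP/pr_add0. Qed.
Fact prq_addN : left_inverse prq_zero prq_opp prq_add.
Proof. by elim/pr_mk_ind=> x; rewrite !prqE; apply/pr_mkP/pr_addN. Qed.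
Fact prq_mulA : associative prq_mul.
Proof.
elim/pr_mk_ind=> x; elim/pr_mk_ind=> y; elim/pr_mk_ind=> z.
by rewrite !prqE; apply/pr_mkP/pr_mulA.
Qed.
Fact prq_mulC : commutative prq_mul.
Proof.
elim/pr_mk_ind=> x; elim/pr_mk_ind=> y.
by rewrite !prqE; apply/pr_mkP/pr_mulC.
Qed.
Fact prq_mul1 : left_id prq_one prq_mul.
Proof. by elim/pr_mk_ind=> x; rewrite !prqE; apply/pr_mkP/pr_mul1. Qed.
Fact prq_mulD : left_distributive prq_mul prq_add.
Proof.
elim/pr_mk_ind=> x; elim/pr_mk_ind=> y; elim/pr_mk_ind=> z.
by rewrite !prqE; apply/pr_mkP/pr_mulD.
Qed.

HB.instance Definition _ :=
  GRing.isZmodule.Build prquot prq_addA prq_addC prq_add0 prq_addN.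
HB.instance Definition _ :=
  GRing.Zmodule_isComPzRing.Build prquot prq_mulA prq_mulC prq_mul1 prq_mulD.

Lemma pr_mk0 : pr_mk (pr_zero P) = 0. Proof. by []. Qed.
Lemma pr_mkN x : pr_mk (pr_opp x) = - pr_mk x.
Proof. by rewrite -prq_oppE. Qed.
Lemma pr_mkD x y : pr_mk (pr_add x y) = pr_mk x + pr_mk y.
Proof. by rewrite -prq_addE. Qed.
Lemma pr_mkM x y : pr_mk (pr_mul x y) = pr_mk x * pr_mk y.
Proof. by rewrite -prq_mulE. Qed.

End PreringQuotient.

Lemma rmorph_of_fun (A B : pzRingType) (f : A -> B) :
  f 1 = 1 -> (forall x y, f (x + y) = f x + f y) ->
  (forall x y, f (x * y) = f x * f y) ->
  {h : {rmorphism A -> B} | forall x, h x = f x}.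
Proof.
move=> f1 fD fM.
have f0 : f 0 = 0 by apply: (addrI (f 0)); rewrite -fD !addr0.
have fN x : f (- x) = - f x.
  by apply/eqP; rewrite -addr_eq0 -fD addNr f0.
have fB : zmod_morphism f by move=> x y; rewrite fD fN.
have f1M : monoid_morphism f by [].
pose g : {rmorphism A -> B} := HB.pack_for {rmorphism A -> B} f
  (GRing.isZmodMorphism.Build A B f fB) (GRing.isMonoidMorphism.Build A B f f1M).
by exists g.
Qed.

Section IdealQuotient.
Variables (A : comPzRingType) (I : A -> Prop) (idI : is_ideal I).

Lemma pideal0 : I 0. Proof. by case: idI. Qed.
Lemma pidealD x y : I x -> I y -> I (x + y). Proof. by case: idI => _ /(_ x y). Qed.
Lemma pidealMr a x : I x -> I (a * x). Proof. by case: idI => _ _ /(_ a x). Qed.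
Lemma pidealMl a x : I x -> I (x * a). Proof. by rewrite mulrC; exact: pidealMr. Qed.
Lemma pidealN x : I x -> I (- x). Proof. by rewrite -mulN1r; exact: pidealMr. Qed.
Lemma pidealB x y : I x -> I y -> I (x - y).
Proof. by move=> Ix Iy; apply: pidealD => //; exact: pidealN. Qed.

Program Definition ideal_prering : prering :=
  @Prering A (fun x y => I (x - y)) 0 1 -%R +%R *%R
  _ _ _ _ _ _ _ _ _ _ _ _ _ _.
Next Obligation. by rewrite subrr; exact: pideal0. Qed.
Next Obligation. by rewrite -opprB; exact: pidealN. Qed.
Next Obligation.
by rewrite -(subrK y x) -addrA; apply: pidealD.
Qed.
Next Obligation. by rewrite -opprD; exact: pidealN. Qed.
Next Obligation. by rewrite opprD addrACA; exact: pidealD. Qed.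
Next Obligation.
have -> : x * y - x' * y' = (x - x') * y + x' * (y - y').
  by rewrite mulrBl mulrBr addrA subrK.
by apply: pidealD; [exact: pidealMl | exact: pidealMr].
Qed.
Next Obligation. by rewrite addrA subrr; exact: pideal0. Qed.
Next Obligation. by rewrite [y + x]addrC subrr; exact: pideal0. Qed.
Next Obligation. by rewrite add0r subrr; exact: pideal0. Qed.
Next Obligation. by rewrite addNr subrr; exact: pideal0. Qed.
Next Obligation. by rewrite mulrA subrr; exact: pideal0. Qed.
Next Obligation. by rewrite [y * x]mulrC subrr; exact: pideal0. Qed.
Next Obligation. by rewrite mul1r subrr; exact: pideal0. Qed.
Next Obligation. by rewrite mulrDl subrr; exact: pideal0. Qed.

Lemma ideal_quotient : exists (Q : comPzRingType) (pi : {rmorphism A -> Q}),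
  (forall y, exists x, pi x = y) /\ (forall x, pi x = 0 <-> I x).
Proof.
pose f : A -> prquot ideal_prering := @pr_mk ideal_prering.
have [pi piE] :
    {h : {rmorphism A -> prquot ideal_prering} | forall x, h x = f x}.
  apply: rmorph_of_fun => // x y; first exact: (@pr_mkD ideal_prering).
  exact: (@pr_mkM ideal_prering).
exists (prquot ideal_prering), pi; split.
  by elim/pr_mk_ind=> x; exists x; rewrite piE.
move=> x; rewrite piE /f -pr_mk0; split.
  by move/pr_mkP => /=; rewrite subr0.
by move=> Ix; apply/pr_mkP => /=; rewrite subr0.
Qed.
End IdealQuotient.

Lemma kernel_ideal (A B : comPzRingType) (f : {rmorphism A -> B}) :
  is_ideal (fun x => f x = 0).
Proof.
split=> [|x y fx fy|a x fx]; first exact: rmorph0.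
  by rewrite rmorphD fx fy addr0.
by rewrite rmorphM fx mulr0.
Qed.

Lemma kernel_prime (A : comPzRingType) (E : fieldType) (f : {rmorphism A -> E}) :
  is_prime (fun x => f x = 0).
Proof.
split; first exact: kernel_ideal.
  by rewrite rmorph1 => /eqP; rewrite oner_eq0.
by move=> x y /eqP; rewrite rmorphM mulf_eq0 => /orP [] /eqP; [left | right].
Qed.

Lemma prime_field (A : comPzRingType) (p : A -> Prop) : is_prime p ->
  exists (E : fieldType) (f : {rmorphism A -> E}), forall x, f x = 0 <-> p x.
Proof.
move=> [idp p1 pM]; have [Q [pi [pi_surj pi0]]] := ideal_quotient idp.
have Q1 : (1 : Q) != 0.
  by apply/eqP => Q10; apply: p1; apply/pi0; rewrite rmorph1.
have QM (x y : Q) : x * y = 0 -> (x == 0) || (y == 0).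
  have [[a <-] [b <-]] := (pi_surj x, pi_surj y).
  by rewrite -rmorphM => /pi0/pM[] /pi0 ->; rewrite eqxx ?orbT.
pose Qnz : comNzRingType := HB.pack Q (GRing.PzSemiRing_isNonZero.Build Q Q1).
(* The field will be the fraction field of A/p. The latter is first made an integral domain with a
   unit predicate, decided classically, and chosen inverses. *)
pose un : pred Qnz := fun x => `[< exists y : Qnz, y * x = 1 >].
pose iv (x : Qnz) : Qnz :=
  if pselect (exists y : Qnz, y * x = 1) is left e then projT1 (cid e) else x.
have ivl : {in un, left_inverse (1 : Qnz) iv *%R}.
  move=> x /asboolP ex; rewrite /iv; case: pselect => // e.
  exact: (projT2 (cid e)).
have unP (x y : Qnz) : y * x = 1 -> un x by move=> yx; apply/asboolP; exists y.
have ivo : {in [predC un], iv =1 id}.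
  move=> x /negP nx; rewrite /iv; case: pselect => // e.
  by case: nx; apply/asboolP.
pose Qun : comUnitRingType := HB.pack Qnz
  (GRing.ComNzRing_hasMulInverse.Build Qnz ivl unP ivo).
pose Qid : idomainType := HB.pack Qun (GRing.ComUnitRing_isIntegral.Build Qun QM).
exists {fraction Qid}.
pose j : {rmorphism Qid -> {fraction Qid}} := @tofrac Qid.
exists (j \o (pi : {rmorphism A -> Qid})) => x /=.
split => [/eqP|px].
  by rewrite tofrac_eq0 => /eqP; exact: (pi0 x).1.
by apply/eqP; rewrite tofrac_eq0; apply/eqP; exact: (pi0 x).2.
Qed.

(** * Terms with an inverse, and weak inverses *)

Inductive iterm (S : Type) : Type :=
  | TConst of S
  | TOpp of iterm S
  | TAdd of iterm S & iterm S
  | TMul of iterm S & iterm S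
  | TInv of iterm S.

Fixpoint ieval (S : Type) (B : pzRingType) (f : S -> B) (inv : B -> B)
    (t : iterm S) : B :=
  match t with
  | TConst s => f s
  | TOpp t => - ieval f inv t
  | TAdd t u => ieval f inv t + ieval f inv u
  | TMul t u => ieval f inv t * ieval f inv u
  | TInv t => inv (ieval f inv t)
  end.

Fixpoint imap (S T : Type) (f : S -> T) (t : iterm S) : iterm T :=
  match t with
  | TConst s => TConst (f s)
  | TOpp t => TOpp (imap f t)
  | TAdd t u => TAdd (imap f t) (imap f u)
  | TMul t u => TMul (imap f t) (imap f u)
  | TInv t => TInv (imap f t)
  end.

Lemma ieval_imap (S T : Type) (B : pzRingType) (f : S -> T) (g : T -> B)
    (inv : B -> B) (t : iterm S) :
  ieval g inv (imap f t) = ieval (g \o f) inv t.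
Proof. by elim: t => //= [t -> | t -> u -> | t -> u -> | t ->]. Qed.

Lemma eq_ieval (S : Type) (B : pzRingType) (f g : S -> B) (inv : B -> B) :
  f =1 g -> ieval f inv =1 ieval g inv.
Proof. by move=> fg; elim=> //= [t -> | t -> u -> | t -> u -> | t ->]. Qed.

Lemma ieval_morph (S : Type) (B C : pzRingType) (f : S -> B) (invB : B -> B)
    (invC : C -> C) (h : {rmorphism B -> C}) (t : iterm S) :
  (forall x, h (invB x) = invC (h x)) ->
  h (ieval f invB t) = ieval (h \o f) invC t.
Proof.
move=> hinv; elim: t => //= [t <- | t <- u <- | t <- u <- | t <-].
- by rewrite rmorphN.
- by rewrite rmorphD.
- by rewrite rmorphM.
- by rewrite hinv.
Qed.

Lemma ieval_field (S : Type) (L L' : fieldType) (f : S -> L)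
    (i : {rmorphism L -> L'}) (t : iterm S) :
  i (ieval f GRing.inv t) = ieval (i \o f) GRing.inv t.
Proof. by apply: ieval_morph => x; exact: fmorphV. Qed.

(* Identifying the terms that agree in all models of a class [M] presents a ring
   by generators and relations, and does not require [S] to be nonzero, as
   polynomial rings would. *)
Section SemanticQuotient.
Variables (S : comPzRingType)
  (M : forall B : comPzRingType, {rmorphism S -> B} -> (B -> B) -> Prop).

Definition sem_eq (t u : iterm S) : Prop :=
  forall (B : comPzRingType) (f : {rmorphism S -> B}) (inv : B -> B),
    M f inv -> ieval f inv t = ieval f inv u.

Program Definition sem_prering : prering :=
  @Prering (iterm S) sem_eq (TConst 0) (TConst 1) (@TOpp S) (@TAdd S) (@TMul S)
  _ _ _ _ _ _ _ _ _ _ _ _ _ _.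
Next Obligation. by []. Qed.
Next Obligation. by move=> B f inv m; rewrite H. Qed.
Next Obligation. by move=> B f inv m; rewrite H ?H0. Qed.
Next Obligation. by move=> B f inv m /=; rewrite H. Qed.
Next Obligation. by move=> B f inv m /=; rewrite H ?H0. Qed.
Next Obligation. by move=> B f inv m /=; rewrite H ?H0. Qed.
Next Obligation. by move=> B f inv m /=; rewrite addrA. Qed.
Next Obligation. by move=> B f inv m /=; rewrite addrC. Qed.
Next Obligation. by move=> B f inv m /=; rewrite rmorph0 add0r. Qed.
Next Obligation. by move=> B f inv m /=; rewrite rmorph0 addNr. Qed.
Next Obligation. by move=> B f inv m /=; rewrite mulrA. Qed.
Next Obligation. by move=> B f inv m /=; rewrite mulrC. Qed.
Next Obligation. by move=> B f inv m /=; rewrite rmorph1 mul1r. Qed.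
Next Obligation. by move=> B f inv m /=; rewrite mulrDl. Qed.

Definition sem_ring : comPzRingType := prquot sem_prering.

Definition sem_mk (t : iterm S) : sem_ring := @pr_mk sem_prering t.

Lemma sem_mkP t u : sem_mk t = sem_mk u <-> sem_eq t u.
Proof. exact: (@pr_mkP sem_prering). Qed.

Lemma sem_mk_surj x : exists t, sem_mk t = x.
Proof. by exists (pr_rep x); exact: pr_repK. Qed.

Lemma sem_mkN t : sem_mk (TOpp t) = - sem_mk t.
Proof. exact: (@pr_mkN sem_prering). Qed.
Lemma sem_mkD t u : sem_mk (TAdd t u) = sem_mk t + sem_mk u.
Proof. exact: (@pr_mkD sem_prering). Qed.
Lemma sem_mkM t u : sem_mk (TMul t u) = sem_mk t * sem_mk u.
Proof. exact: (@pr_mkM sem_prering). Qed.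

Fact sem_const_subproof :
  {h : {rmorphism S -> sem_ring} | forall s, h s = sem_mk (TConst s)}.
Proof.
apply: (@rmorph_of_fun _ _ (fun s => sem_mk (TConst s))) => [//|x y|x y].
  by rewrite -sem_mkD; apply/sem_mkP => B f inv m /=; rewrite rmorphD.
by rewrite -sem_mkM; apply/sem_mkP => B f inv m /=; rewrite rmorphM.
Qed.
Definition sem_const : {rmorphism S -> sem_ring} := sval sem_const_subproof.

Lemma sem_constE s : sem_const s = sem_mk (TConst s).
Proof. exact: (svalP sem_const_subproof). Qed.

Definition sem_inv (x : sem_ring) : sem_ring := sem_mk (TInv (pr_rep x)).

Lemma sem_mkV t : sem_mk (TInv t) = sem_inv (sem_mk t).
Proof.
apply/sem_mkP => B f inv m /=; congr inv.
have /sem_mkP H : sem_mk (pr_rep (sem_mk t)) = sem_mk t by exact: pr_repK.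
by rewrite H.
Qed.

Lemma ieval_sem t : ieval sem_const sem_inv t = sem_mk t.
Proof.
elim: t => /= [s | t -> | t -> u -> | t -> u -> | t ->].
- exact: sem_constE.
- by rewrite sem_mkN.
- by rewrite sem_mkD.
- by rewrite sem_mkM.
- by rewrite sem_mkV.
Qed.

Lemma sem_eval (B : comPzRingType) (f : {rmorphism S -> B}) (inv : B -> B) :
  (forall t u, sem_eq t u -> ieval f inv t = ieval f inv u) ->
  {h : {rmorphism sem_ring -> B} | forall t, h (sem_mk t) = ieval f inv t}.
Proof.
move=> fE; pose h (x : sem_ring) := ieval f inv (pr_rep x).
have hE t : h (sem_mk t) = ieval f inv t.
  by apply: fE; apply/sem_mkP; exact: pr_repK.
have [|||k kE] := @rmorph_of_fun _ _ h.
- by rewrite -(rmorph1 sem_const) sem_constE hE /= rmorph1.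
- move=> x y; have [[t <-] [u <-]] := (sem_mk_surj x, sem_mk_surj y).
  by rewrite -sem_mkD !hE.
- move=> x y; have [[t <-] [u <-]] := (sem_mk_surj x, sem_mk_surj y).
  by rewrite -sem_mkM !hE.
by exists k => t; rewrite kE hE.
Qed.

Lemma sem_model_eval (B : comPzRingType) (f : {rmorphism S -> B})
    (inv : B -> B) : M f inv ->
  {h : {rmorphism sem_ring -> B} | forall t, h (sem_mk t) = ieval f inv t}.
Proof. by move=> m; apply: sem_eval => t u; exact. Qed.

End SemanticQuotient.

Section WeakInverse.
Variable A : comPzRingType.
Implicit Types x y : A.

Definition weak_inverse x y : Prop := x * x * y = x /\ x * y * y = y.

(** Substituting the identities into each other turns both [y] and [z] into [x * y * z]. This
    uniqueness later yields descent of weak inverses and uniqueness of morphisms out of rings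
    generated by them. *)
Lemma weak_inverse_unique x y z :
  weak_inverse x y -> weak_inverse x z -> y = z.
Proof.
move=> [xy yx] [xz zx].
have yE : y = x * y * z.
  rewrite -[y in LHS]yx -[x in LHS]xz -[x in RHS]xy; ring.
have zE : z = x * y * z.
  rewrite -[z in LHS]zx -[x in LHS]xy -[x in RHS]xz; ring.
by rewrite yE -zE.
Qed.

Lemma weak_inverse00 : weak_inverse 0 0.
Proof. by split; rewrite !mul0r. Qed.

(** Repeated substitution of [x * x * y = x] gives [x = x ^+ k.+1 * y ^+ k] for every [k]. *)
Lemma weak_inverse_nilpotent x y n : weak_inverse x y -> x ^+ n = 0 -> x = 0.
Proof.
move=> [xy _] xn; have xE k : x = x ^+ k.+1 * y ^+ k.
  elim: k => [|k IHk]; first by rewrite expr1 mulr1.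
  have -> : x ^+ k.+2 * y ^+ k.+1 = x * (x ^+ k.+1 * y ^+ k) * y.
    by rewrite (exprS x) (exprS y) -!mulrA [y ^+ k * y]mulrC.
  by rewrite -IHk xy.
by rewrite (xE n) exprS xn mulr0 mul0r.
Qed.

End WeakInverse.

Lemma weak_inverse_morph (A B : comPzRingType) (h : {rmorphism A -> B}) x y :
  weak_inverse x y -> weak_inverse (h x) (h y).
Proof. by case=> xy yx; split; rewrite -!rmorphM ?xy ?yx. Qed.

Lemma weak_inverse_field (L : fieldType) (x : L) : weak_inverse x x^-1.
Proof.
have [->|x0] := eqVneq x 0; first by rewrite invr0; exact: weak_inverse00.
by split; rewrite ?mulfK // mulfV ?mul1r.
Qed.

(** * Prime ideals and noetherian rings *)

Section PrimeAvoidance.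
Variables (A : comPzRingType) (x y : A).

(* The zero element is treated apart because the empty set has to qualify in
   Zorn's lemma for chains under inclusion. *)
Let weak (I : set A) (z : A) : Prop := I z \/ z = 0.

Let admissible (I : set A) : Prop :=
  [/\ forall u v, I u -> I v -> I (u + v), forall a u, I u -> I (a * u) &
      forall n i a, weak I i -> y ^+ n <> i + a * x].

Let adjoin (I : set A) (b : A) : set A :=
  fun z => exists i r, weak I i /\ z = i + r * b.

(** An ideal [J] maximal for the condition that no power of [y] lies in J + (x) contains [x] and is
    prime: for [a], [b] outside [J], powers of [y] lie in J + (a) + (x) and in J + (b) + (x), and
    their product would lie in J + (x) if [a * b] were in [J]. *)
Lemma prime_avoiding : (forall n a, y ^+ n <> a * x) ->
  exists p : A -> Prop, [/\ is_prime p, p x & ~ p y].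
Proof.
move=> yx; have [F FP Ftot|J [[JD JM Jy] Jmax]] := @Zorn_bigcup A admissible.
  split=> [u v [I FI Iu] [J FJ Jv]|a u [I FI Iu]|n i a].
  - have [IJ|JI] := Ftot _ _ FI FJ.
      by exists J => //; have [D _ _] := FP _ FJ; apply: D => //; exact: IJ.
    by exists I => //; have [D _ _] := FP _ FI; apply: D => //; exact: JI.
  - by exists I => //; have [_ M _] := FP _ FI; exact: M.
  - case=> [[I FI Ii]|->]; last by rewrite add0r; exact: yx.
    by have [_ _ N] := FP _ FI; apply: N; left.
have wD u v : weak J u -> weak J v -> weak J (u + v).
  case=> [Ju|->]; last by rewrite add0r.
  by case=> [Jv|->]; [left; exact: JD | rewrite addr0; left].
have wM a u : weak J u -> weak J (a * u).
  by case=> [Ju|->]; [left; exact: JM | right; rewrite mulr0].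
have step b : ~ J b -> exists n i r c, weak J i /\ y ^+ n = i + r * b + c * x.
  move=> nJb; apply: contrapT => nex.
  have sub : J `<` adjoin J b.
    split=> [|/(_ b) H]; last first.
      by apply/nJb/H; exists 0, 1; rewrite mul1r add0r; split=> //; right.
    by move=> z Jz; exists z, 0; rewrite mul0r addr0; split=> //; left.
  apply: (Jmax _ sub); split.
  - move=> u v [i [r [wi ->]]] [j [s [wj ->]]]; exists (i + j), (r + s).
    by split; [exact: wD | rewrite mulrDl addrACA].
  - move=> a u [i [r [wi ->]]]; exists (a * i), (a * r).
    by split; [exact: wM | rewrite mulrDr mulrA].
  - move=> n z a [[i [r [wi ->]]] yE|-> yE]; apply: nex.
      by exists n, i, r, a.
    by exists n, 0, 0, a; split; [right | rewrite mul0r !add0r -[RHS]add0r].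
have J0 : J 0.
  apply: contrapT => /step [n [i [r [c [wi]]]]]; rewrite mulr0 addr0.
  exact: Jy.
have wJ u : weak J u -> J u by case=> // ->.
have Jx : J x.
  apply: contrapT => /step [n [i [r [c [wi]]]]]; rewrite -addrA -mulrDl.
  exact: Jy.
have ny n : ~ J (y ^+ n).
  by move=> Jyn; apply: (Jy n (y ^+ n) 0); [left | rewrite mul0r addr0].
exists J; split; [split | exact: Jx | by have := ny 1%N; rewrite expr1].
- by split.
- by have := ny 0%N; rewrite expr0.
move=> a b Jab; apply: contrapT => /not_orP [/step na /step nb].
have [n [i [r [c [/wJ Ji yn]]]]] := na; have [m [j [s [d [/wJ Jj ym]]]]] := nb.
apply: (ny (n + m)%N); rewrite exprD yn ym.
have -> : (i + r * a + c * x) * (j + s * b + d * x) =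
  (j + s * b + d * x) * i + (r * a * j + (r * s * (a * b) +
   (r * a * d + c * (j + s * b + d * x)) * x)) by ring.
apply: (JD _ _ (JM _ _ Ji)); apply: (JD _ _ (JM _ _ Jj)).
by apply: (JD _ _ (JM _ _ Jab)); exact: JM.
Qed.
End PrimeAvoidance.

Lemma unit_of_no_prime (A : comPzRingType) (x : A) :
  (forall p : A -> Prop, is_prime p -> ~ p x) -> exists y, x * y = 1.
Proof.
move=> nox; apply: contrapT => nex.
have [|p [pp px _]] := @prime_avoiding A x 1; last exact: (nox p pp px).
by move=> n a; rewrite expr1n => xa; apply: nex; exists a; rewrite mulrC.
Qed.

Lemma nilpotent_of_fields (A : comPzRingType) (x : A) :
  (forall (L : fieldType) (f : {rmorphism A -> L}), f x = 0) ->
  exists n, x ^+ n = 0.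
Proof.
move=> fx; apply: contrapT => nex.
have [|p [pp _ px]] := @prime_avoiding A 0 x.
  by move=> n a; rewrite mulr0 => xn; apply: nex; exists n.
by have [L [f fE]] := prime_field pp; apply/px/fE/fx.
Qed.

(** The chain form of the noetherian condition transfers directly to surjective images and to
    polynomial rings. *)
Definition acc (A : comPzRingType) : Prop :=
  forall I : nat -> A -> Prop, (forall k, is_ideal (I k)) ->
    (forall k x, I k x -> I k.+1 x) ->
    exists N, forall k x, (N <= k)%N -> I k x -> I N x.

Lemma chain_le (A : Type) (I : nat -> A -> Prop) :
  (forall k x, I k x -> I k.+1 x) -> forall m n x, (m <= n)%N -> I m x -> I n x.
Proof.
move=> IS m n x /subnKC <-; elim: (n - m)%N => [|d IHd]; first by rewrite addn0.
by rewrite addnS => Im; apply/IS/IHd.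
Qed.

Lemma noetherian_acc (A : comPzRingType) : noetherian A -> acc A.
Proof.
move=> nA I Iid IS; have Ile := chain_le IS.
pose U x := exists k, I k x.
have [|s sE] := nA U.
  split; first by exists 0%N; apply: pideal0.
    move=> x y [k Ikx] [l Ily]; exists (maxn k l); apply: pidealD => //.
      by apply: Ile Ikx; exact: leq_maxl.
    by apply: Ile Ily; exact: leq_maxr.
  by move=> a x [k Ikx]; exists k; apply: pidealMr => //.
have sU y : y \in s -> U y by move=> ys; apply/sE => J _; exact.
have [N NP] : exists N, forall y, y \in s -> I N y.
  elim: s sU {sE} => [|z s IHs] sU; first by exists 0%N.
  have [|N NP] := IHs; first by move=> y ys; apply: sU; rewrite inE ys orbT.
  have [k Ikz] := sU z (mem_head _ _); exists (maxn N k) => y.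
  rewrite inE => /orP [/eqP ->|/NP]; first by apply: Ile Ikz; exact: leq_maxr.
  by apply: Ile; exact: leq_maxl.
exists N => k x _ Ikx; have /sE : U x by exists k.
by apply.
Qed.

Lemma acc_surj (A B : comPzRingType) (f : {rmorphism A -> B}) :
  (forall y, exists x, f x = y) -> acc A -> acc B.
Proof.
move=> fs aA I Iid IS; have [|k x|N NP] := aA (fun k x => I k (f x)).
- move=> k; split; first by rewrite rmorph0; apply: pideal0.
    by move=> x y; rewrite rmorphD; apply: pidealD => //.
  by move=> a x; rewrite rmorphM; apply: pidealMr => //.
- exact: IS.
by exists N => k y Nk; have [x <-] := fs y; exact: NP.
Qed.

(* Hilbert's basis theorem, via the ideals of leading coefficients. *)
Lemma acc_poly (A : comNzRingType) : acc A -> acc {poly A}.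
Proof.
move=> aA I Iid IS; have Ile := chain_le IS.
pose lead n k c := exists P : {poly A}, [/\ I k P, (size P <= n.+1)%N & P`_n = c].
have lead_id n k : is_ideal (lead n k).
  split.
    by exists 0; rewrite size_poly0 coef0; split=> //; apply: pideal0.
    move=> _ _ [P [IP sP <-]] [Q [IQ sQ <-]]; exists (P + Q); split.
    - apply: pidealD => //.
    - by rewrite (leq_trans (size_polyD _ _)) // geq_max sP.
    - by rewrite coefD.
  move=> a _ [P [IP sP <-]]; exists (a%:P * P); split.
  - apply: pidealMr => //.
  - by rewrite mul_polyC (leq_trans (size_scale_leq _ _)).
  - by rewrite coefCM.
have leadSk n k c : lead n k c -> lead n k.+1 c.
  by case=> P [IP sP cP]; exists P; split=> //; exact: IS.
have leadSn n k c : lead n k c -> lead n.+1 k c.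
  case=> P [IP sP cP]; exists (P * 'X); split.
  - apply: pidealMl => //.
  - rewrite (leq_trans (size_polyMleq _ _)) // size_polyX addn2 /=.
    by rewrite ltnS.
  - by rewrite coefMX.
have leadk n := chain_le (leadSk n).
have leadn k := @chain_le _ (fun n => lead n k) (fun n => @leadSn n k).
(* The diagonal chain controls all degrees from [N] on; the finitely many degrees below [N]
   stabilize at a common [M]. *)
have [//|N NP] := aA (fun k => lead k k) (fun k => lead_id k k).
  by move=> k x /leadSk; exact: leadSn.
have [M MP] : exists M, forall n, (n < N)%N -> forall k c, (M <= k)%N ->
    lead n k c -> lead n M c.
  elim: N {NP} => [|N [M MP]]; first by exists 0%N.
  have [K KP] := aA (lead N) (lead_id N) (leadSk N).
  exists (maxn M K) => n; rewrite ltnS leq_eqVlt => /orP [/eqP ->|nN] k c.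
    rewrite geq_max => /andP [_ Kk] /(KP _ _ Kk).
    by apply: leadk; exact: leq_maxr.
  rewrite geq_max => /andP [Mk _] /(MP n nN _ _ Mk).
  by apply: leadk; exact: leq_maxl.
pose W := maxn M N.
have stab n k c : (W <= k)%N -> lead n k c -> lead n W c.
  rewrite geq_max => /andP [Mk Nk] lc; have [nN|Nn] := ltnP n N.
    by apply: leadk (MP _ nN _ _ Mk lc); exact: leq_maxl.
  have : lead N N c.
    apply: (NP (maxn n k)); first by rewrite leq_max Nn.
    by apply: (leadn _ n); [exact: leq_maxl | apply: leadk lc; exact: leq_maxr].
  by move=> /(leadn _ _ _ _ Nn); apply: leadk; exact: leq_maxr.
exists W => k P Wk.
have [n sP] : exists n, (size P <= n)%N by exists (size P).
elim: n P sP => [|n IHn] P sP IP.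
  by move: sP; rewrite leqn0 size_poly_eq0 => /eqP ->; apply: pideal0.
(* Subtracting an element of [I W] with the same coefficient in degree [n] lowers the degree bound
   of [P]. *)
have [|Q [IQ sQ cQ]] := stab n k P`_n Wk; first by exists P.
rewrite -(subrK Q P); apply: pidealD => //; apply: IHn; last first.
  by apply: pidealB => //; apply: Ile IQ.
apply/leq_sizeP => j nj; rewrite coefB.
have [<-|jn] := eqVneq n j; first by rewrite cQ subrr.
have nj' : (n < j)%N by rewrite ltn_neqAle jn.
by rewrite !nth_default ?subrr // ?(leq_trans sP) ?(leq_trans sQ).
Qed.

(** Every counterexample would have a strictly larger one, and iterating a choice of these gives a
    chain that never becomes stationary. *)
Lemma noetherian_induction (A : comPzRingType) (Q : (A -> Prop) -> Prop) :
  acc A ->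
  (forall I, is_ideal I ->
     (forall J, is_ideal J -> (forall x, I x -> J x) ->
       (exists x, J x /\ ~ I x) -> Q J) -> Q I) ->
  forall I, is_ideal I -> Q I.
Proof.
move=> aA step I0 id0; apply: contrapT => nQ0.
pose T := {I : A -> Prop | is_ideal I /\ ~ Q I}.
have next (I : T) : exists J : T,
    (forall x, sval I x -> sval J x) /\ (exists x, sval J x /\ ~ sval I x).
  case: I => I [idI nQ] /=; apply: contrapT => nex; apply: nQ.
  apply: step => // J idJ IJ xIJ; apply: contrapT => nQJ; apply: nex.
  by exists (exist _ J (conj idJ nQJ)).
have [nx nxP] := choice next.
pose c k : T := iter k nx (exist _ I0 (conj id0 nQ0)).
have [k|k x|N NP] := aA (fun k => sval (c k)); first by case: (svalP (c k)).
  exact: (nxP (c k)).1.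
have [x [cx nx']] := (nxP (c N)).2.
by apply: nx'; apply: (NP N.+1).
Qed.

Definition generated (A B : comPzRingType) (f : A -> B) (s : seq B) : Prop :=
  forall P : B -> Prop,
    (forall r, P (f r)) -> (forall x, x \in s -> P x) ->
    (forall x y, P x -> P y -> P (x + y)) ->
    (forall x y, P x -> P y -> P (x * y)) ->
    forall x, P x.

Lemma generated_nil (A B : comPzRingType) (f : {rmorphism A -> B}) :
  generated f [::] -> forall y, exists x, f x = y.
Proof.
move=> gen; apply: gen => // [x|_ _ [x <-] [y <-]|_ _ [x <-] [y <-]].
- by exists x.
- by exists (x + y); rewrite rmorphD.
- by exists (x * y); rewrite rmorphM.
Qed.

Section EvalMorph.
Variables (A : comNzRingType) (B : comNzRingType) (f : {rmorphism A -> B}) (x : B).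

Fact eval_morph_comm : commr_rmorph f x. Proof. by move=> a; exact: mulrC. Qed.

Definition eval_morph : {rmorphism {poly A} -> B} := horner_morph eval_morph_comm.
Arguments eval_morph : simpl never.

Lemma eval_morphE P : eval_morph P = (map_poly f P).[x]. Proof. by []. Qed.

Lemma eval_morphC a : eval_morph a%:P = f a.
Proof. by rewrite eval_morphE map_polyC hornerC. Qed.

Lemma eval_morphX : eval_morph 'X = x.
Proof. by rewrite eval_morphE map_polyX hornerX. Qed.

Lemma generated_cons s : generated f (x :: s) -> generated eval_morph s.
Proof.
move=> gen P Pf Ps PD PM; apply: gen => // [r|z].
  by rewrite -eval_morphC.
by rewrite inE => /orP [/eqP ->|/Ps //]; rewrite -eval_morphX.
Qed.
End EvalMorph.

(** The first generator is absorbed by passing from [A] to [{poly A}], over which the others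
    generate [B]; hence [A] varies in the induction. *)
Lemma acc_generated (s : nat) (A B : comNzRingType) (f : {rmorphism A -> B})
    (t : seq B) : size t = s -> generated f t -> acc A -> acc B.
Proof.
elim: s A f t => [|s IHs] A f [|x t] //= st gen aA.
  exact: acc_surj (generated_nil gen) aA.
move: st => [/IHs]; apply; last exact: acc_poly aA.
exact: generated_cons gen.
Qed.

Lemma falg_acc (R : comPzRingType) (S : falg R) : noetherian R -> acc S.
Proof.
move=> nR; have [S1|S1] := eqVneq (1 : S) 0.
  move=> I Iid _; exists 0%N => k x _ _.
  by rewrite -(mul1r x) S1 mul0r; apply: pideal0.
have R1 : (1 : R) != 0.
  apply: contra_neq S1 => R10.
  by rewrite -(rmorph1 (falg_str S)) R10 rmorph0.
pose Rnz : comNzRingType := HB.pack (R : Type) (GRing.ComPzRing.class R)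
  (GRing.PzSemiRing_isNonZero.Build R R1).
pose Snz : comNzRingType := HB.pack (falg_ring S : Type)
  (GRing.ComPzRing.class (falg_ring S)) (GRing.PzSemiRing_isNonZero.Build S S1).
have [t gen] := falg_fg S.
exact: (@acc_generated _ Rnz Snz (falg_str S) t erefl gen (noetherian_acc nR)).
Qed.

(** * Constructible functions *)

Inductive field_model (S : comPzRingType) :
    forall B : comPzRingType, {rmorphism S -> B} -> (B -> B) -> Prop :=
  FieldModel (L : fieldType) (f : {rmorphism S -> L}) :
    @field_model S L f GRing.inv.

Definition cfun (S : comPzRingType) : comPzRingType :=
  sem_ring (@field_model S).

Section CFun.
Variable S : comPzRingType.

Definition cf_mk (t : iterm S) : cfun S := sem_mk (@field_model S) t.
Definition cf_const : {rmorphism S -> cfun S} := sem_const (@field_model S).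
Definition cf_inv : cfun S -> cfun S := @sem_inv S (@field_model S).

Definition cf_eval (L : fieldType) (f : {rmorphism S -> L}) :
  {rmorphism cfun S -> L} := sval (sem_model_eval (FieldModel f)).

Lemma cf_evalE (L : fieldType) (f : {rmorphism S -> L}) t :
  cf_eval f (cf_mk t) = ieval f GRing.inv t.
Proof. exact: (svalP (sem_model_eval (FieldModel f))). Qed.

Lemma cf_mk_surj (x : cfun S) : exists t, cf_mk t = x.
Proof. exact: sem_mk_surj. Qed.

Lemma cf_ext (x y : cfun S) :
  (forall (L : fieldType) (f : {rmorphism S -> L}), cf_eval f x = cf_eval f y) ->
  x = y.
Proof.
have [[t <-] [u <-]] := (cf_mk_surj x, cf_mk_surj y) => tu.
apply/sem_mkP => B f inv [L f'].
by rewrite -!cf_evalE tu.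
Qed.

Lemma eq_cf_eval (L : fieldType) (f g : {rmorphism S -> L}) :
  f =1 g -> cf_eval f =1 cf_eval g.
Proof.
by move=> fg x; have [t <-] := cf_mk_surj x; rewrite !cf_evalE; exact: eq_ieval.
Qed.

Lemma cf_eval_const (L : fieldType) (f : {rmorphism S -> L}) s :
  cf_eval f (cf_const s) = f s.
Proof. by rewrite [cf_const s]sem_constE cf_evalE. Qed.

Lemma cf_eval_inv (L : fieldType) (f : {rmorphism S -> L}) x :
  cf_eval f (cf_inv x) = (cf_eval f x)^-1.
Proof.
have [t <-] := cf_mk_surj x.
by rewrite /cf_inv -[sem_inv _]sem_mkV [LHS]cf_evalE cf_evalE.
Qed.

Lemma cf_eval_comp (L L' : fieldType) (i : {rmorphism L -> L'})
    (f : {rmorphism S -> L}) x :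
  cf_eval (i \o f) x = i (cf_eval f x).
Proof. by have [t <-] := cf_mk_surj x; rewrite !cf_evalE ieval_field. Qed.

Lemma cf_inv_weak x : weak_inverse x (cf_inv x).
Proof.
by split; apply: cf_ext => L f; rewrite !rmorphM /= cf_eval_inv;
  case: (weak_inverse_field (cf_eval f x)).
Qed.

Lemma cf_ind (P : cfun S -> Prop) :
  (forall s, P (cf_const s)) -> (forall x, P x -> P (- x)) ->
  (forall x y, P x -> P y -> P (x + y)) ->
  (forall x y, P x -> P y -> P (x * y)) ->
  (forall x, P x -> P (cf_inv x)) -> forall x, P x.
Proof.
move=> Pc PN PD PM PV x; have [t <-] := cf_mk_surj x.
elim: t => [s | t IHt | t IHt u IHu | t IHt u IHu | t IHt].
- by rewrite /cf_mk -sem_constE; exact: Pc.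
- by rewrite /cf_mk sem_mkN; exact: PN.
- by rewrite /cf_mk sem_mkD; exact: PD.
- by rewrite /cf_mk sem_mkM; exact: PM.
- by rewrite /cf_mk sem_mkV; exact: PV.
Qed.

(** Each operation imposes further nonvanishing conditions on V(p); as [p] is prime, the product [b]
    of the denominators stays outside [p]. *)
Lemma cf_local (p : S -> Prop) (x : cfun S) : is_prime p ->
  exists a b : S, ~ p b /\
    forall (L : fieldType) (f : {rmorphism S -> L}),
      (forall s, p s -> f s = 0) -> f b != 0 -> cf_eval f x = f a / f b.
Proof.
move=> [idp p1 pM]; elim/cf_ind: x => [s|x|x y|x y|x].
- exists s, 1; split=> // L f _ _.
  by rewrite cf_eval_const rmorph1 divr1.
- move=> [a [b [pb ab]]]; exists (- a), b; split=> // L f fp fb.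
  by rewrite rmorphN ab // rmorphN mulNr.
- move=> [a [b [pb ab]]] [c [d [pd cd]]].
  exists (a * d + c * b), (b * d); split=> [/pM[]//|L f fp].
  rewrite rmorphM mulf_eq0 negb_or => /andP [fb fd].
  by rewrite rmorphD ab // cd // addf_div // rmorphD !rmorphM.
- move=> [a [b [pb ab]]] [c [d [pd cd]]].
  exists (a * c), (b * d); split=> [/pM[]//|L f fp].
  rewrite rmorphM mulf_eq0 negb_or => /andP [fb fd].
  by rewrite rmorphM ab // cd // mulf_div rmorphM.
(* If [a] lies in [p], the value is 0 and so is its inverse. Otherwise the inverse is written with
   denominator [a * b] instead of [a], so that a nonzero denominator also gives [f b != 0], which
   the induction hypothesis requires. *)
- move=> [a [b [pb ab]]]; have [pa|pa] := EM (p a).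
    exists 0, b; split=> // L f fp fb.
    by rewrite cf_eval_inv ab // (fp a pa) !(rmorph0, mul0r, invr0).
  exists (b * b), (a * b); split=> [/pM[]//|L f fp].
  rewrite rmorphM mulf_eq0 negb_or => /andP [fa fb].
  by rewrite cf_eval_inv ab // !rmorphM invf_div -mulf_div divff ?mulr1.
Qed.

(** Ring morphisms preserve weak inverses, which are unique, so agreement at [x] propagates to
    [cf_inv x]. *)
Lemma cf_ringmorph_unique (B : comPzRingType) (h k : {rmorphism cfun S -> B}) :
  (forall s, h (cf_const s) = k (cf_const s)) -> h =1 k.
Proof.
move=> hk; elim/cf_ind => [s|x IHx|x y IHx IHy|x y IHx IHy|x IHx].
- exact: hk.
- by rewrite !rmorphN IHx.
- by rewrite !rmorphD IHx IHy.
- by rewrite !rmorphM IHx IHy.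
apply: (@weak_inverse_unique _ (h x)).
  exact/weak_inverse_morph/cf_inv_weak.
by rewrite IHx; exact/weak_inverse_morph/cf_inv_weak.
Qed.

End CFun.

Lemma cf_map_subproof (S T : comPzRingType) (h : {rmorphism S -> T}) (t u : iterm S) :
  sem_eq (@field_model S) t u ->
  ieval (cf_const T \o h : {rmorphism S -> cfun T}) (@cf_inv T) t =
  ieval (cf_const T \o h : {rmorphism S -> cfun T}) (@cf_inv T) u.
Proof.
move=> tu; rewrite -!(ieval_imap h (cf_const T)) !ieval_sem.
apply: cf_ext => L f; rewrite !cf_evalE !ieval_imap.
exact: (tu L (f \o h) GRing.inv (FieldModel _)).
Qed.

Definition cf_map (S T : comPzRingType) (h : {rmorphism S -> T}) :
  {rmorphism cfun S -> cfun T} := sval (sem_eval (@cf_map_subproof S T h)).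

Lemma cf_map_mk (S T : comPzRingType) (h : {rmorphism S -> T}) t :
  cf_map h (cf_mk t) = cf_mk (imap h t).
Proof.
rewrite [LHS](svalP (sem_eval (@cf_map_subproof S T h))) /=.
by rewrite -(ieval_imap h (cf_const T)) ieval_sem.
Qed.

Lemma cf_eval_map (S T : comPzRingType) (h : {rmorphism S -> T}) (L : fieldType)
    (f : {rmorphism T -> L}) x :
  cf_eval f (cf_map h x) = cf_eval (f \o h) x.
Proof.
by have [t <-] := cf_mk_surj x; rewrite cf_map_mk !cf_evalE ieval_imap.
Qed.

Lemma cf_map_const (S T : comPzRingType) (h : {rmorphism S -> T}) s :
  cf_map h (cf_const S s) = cf_const T (h s).
Proof. by apply: cf_ext => L f; rewrite cf_eval_map !cf_eval_const. Qed.

Section CFunPresheaf.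
Variable R : comPzRingType.

Fact cf_res_ext (S T : falg R) (f g : falg_hom S T) :
  f =1 g -> cf_map f =1 cf_map g.
Proof.
move=> fg x; apply: cf_ext => L h; rewrite !cf_eval_map.
by apply: eq_cf_eval => s /=; rewrite fg.
Qed.

Fact cf_res_id (S : falg R) x : cf_map (falg_id S) x = x.
Proof. by apply: cf_ext => L h; rewrite cf_eval_map; exact: eq_cf_eval. Qed.

Fact cf_res_comp (S T U : falg R) (g : falg_hom T U) (f : falg_hom S T) x :
  cf_map (falg_comp g f) x = cf_map g (cf_map f x).
Proof. by apply: cf_ext => L h; rewrite !cf_eval_map; exact: eq_cf_eval. Qed.

Definition cf_presheaf : presheaf R :=
  @Presheaf R (fun S => cfun S) (fun S T f => cf_map f)
    cf_res_ext cf_res_id cf_res_comp.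

Definition cf_eta : presheaf_hom (structure_presheaf R) cf_presheaf :=
  @PresheafHom R (structure_presheaf R) cf_presheaf (fun S => cf_const S)
    (fun S T f x => esym (cf_map_const f x)).

Lemma cf_phom_unique (G : presheaf R) (h k : presheaf_hom cf_presheaf G) :
  (forall (S : falg R) (s : S), h S (cf_const S s) = k S (cf_const S s)) ->
  forall S, h S =1 k S.
Proof. by move=> hk S; apply: cf_ringmorph_unique => s; exact: hk. Qed.

End CFunPresheaf.

(** * The covering adjoining a weak inverse *)

Section WeakInverseRing.
Variables (S : comPzRingType) (b : S).

Definition wi_model (B : comPzRingType) (f : {rmorphism S -> B}) (inv : B -> B) :
    Prop :=
  weak_inverse (f b) (inv 0) /\ forall z, inv z = inv 0.

(* S[x] / (b^2 x - b, b x^2 - x), isomorphic to S/(b) * S[1/b]; the operation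
   [inv] of its models is constant, so that [TInv] stands for x. *)
Definition wi_ring : comPzRingType := sem_ring wi_model.
Definition wi_const : {rmorphism S -> wi_ring} := sem_const wi_model.
Definition wi_elt : wi_ring := sem_mk wi_model (TInv (TConst 0)).

Lemma wi_eltP : weak_inverse (wi_const b) wi_elt.
Proof.
rewrite /wi_const sem_constE /wi_elt.
set c := TConst b; set x := TInv (TConst 0); split.
  rewrite -(sem_mkM wi_model c c) -(sem_mkM wi_model (TMul c c) x).
  by apply/sem_mkP => B f inv [[m1 m2] _] /=; rewrite rmorph0 m1.
rewrite -(sem_mkM wi_model c x) -(sem_mkM wi_model (TMul c x) x).
by apply/sem_mkP => B f inv [[m1 m2] _] /=; rewrite rmorph0 m2.
Qed.

Lemma wi_mkV t : sem_mk wi_model (TInv t) = wi_elt.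
Proof. by apply/sem_mkP => B f inv [_ m] /=; rewrite m rmorph0. Qed.

Lemma wi_generated : generated wi_const [:: wi_elt].
Proof.
move=> P Pc Px PD PM x; have {x} [t <-] := sem_mk_surj x.
elim: t => [s | t IHt | t IHt u IHu | t IHt u IHu | t IHt].
- by rewrite -sem_constE; exact: Pc.
- rewrite sem_mkN -mulN1r -(rmorph1 wi_const) -rmorphN.
  by apply: PM => //; exact: Pc.
- by rewrite sem_mkD; exact: PD.
- by rewrite sem_mkM; exact: PM.
- by rewrite wi_mkV; apply: Px; rewrite inE.
Qed.

Lemma wi_epi (B : comPzRingType) (h k : {rmorphism wi_ring -> B}) :
  (forall s, h (wi_const s) = k (wi_const s)) -> h =1 k.
Proof.
move=> hk; apply: wi_generated => // [z|x y hx hy|x y hx hy].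
- rewrite inE => /eqP ->; apply: (@weak_inverse_unique _ (h (wi_const b))).
    exact: (weak_inverse_morph h wi_eltP).
  by rewrite hk; exact: (weak_inverse_morph k wi_eltP).
- by rewrite !rmorphD hx hy.
- by rewrite !rmorphM hx hy.
Qed.

Lemma wi_lift (B : comPzRingType) (f : {rmorphism S -> B}) (y : B) :
  weak_inverse (f b) y ->
  {h : {rmorphism wi_ring -> B} | forall s, h (wi_const s) = f s}.
Proof.
move=> fby; have m : wi_model f (fun _ => y) by split.
exists (sval (sem_model_eval m)) => s.
by rewrite [wi_const s]sem_constE (svalP (sem_model_eval m)).
Qed.

End WeakInverseRing.

Lemma generated_comp (A B C : comPzRingType) (f : {rmorphism A -> B})
    (g : {rmorphism B -> C}) s t :
  generated f s -> generated g t -> generated (g \o f) (map g s ++ t).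
Proof.
move=> fs gt P Pf Ps PD PM; apply: gt => // [|z zt]; last first.
  by apply: Ps; rewrite mem_cat zt orbT.
apply: fs => [//|x xs|x y|x y]; rewrite ?rmorphD ?rmorphM; [|exact: PD|exact: PM].
by apply: Ps; rewrite mem_cat map_f.
Qed.

Section WeakInverseCover.
Variables (R : comPzRingType) (S : falg R) (b : S).

Fact wi_falg_fg : finitely_generated (wi_const b \o falg_str S).
Proof.
have [s gen] := falg_fg S; exists (map (wi_const b) s ++ [:: wi_elt b]).
exact: (@generated_comp _ _ _ (falg_str S) (wi_const b) s _ gen
  (wi_generated (b := b))).
Qed.

Definition wi_falg : falg R :=
  @FAlg R (wi_ring b) (wi_const b \o falg_str S) wi_falg_fg.

Definition wi_hom : falg_hom S wi_falg :=
  @FAlgHom R S wi_falg (wi_const b) (fun r => erefl).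

(** The open subscheme D(b), with all of Spec S as the closed subscheme around it. *)
Let wi_open : loc_closed S :=
  @LocClosed S S idfun (fun y => ex_intro _ y erefl) (fun y => y = b).

(** At a valued point no prime of [B] contains the value of [b], so this value is a unit and its
    inverse is a weak inverse. Naturality holds because morphisms out of [wi_ring b] are determined
    on [S]. *)
Lemma wi_open_lift : inhabited (lc_lift wi_hom wi_open).
Proof.
have inv (B : comPzRingType) (a : {rmorphism S -> B}) :
    lc_valued_point (Y := wi_open) a -> {y | weak_inverse (a b) y}.
  move=> ha; apply: cid; have [|y aby] := @unit_of_no_prime B (a b).
    by move=> p pp; have [_ [e [-> ]]] := ha p pp.
  exists y; split; first by rewrite -mulrA aby mulr1.
  by rewrite aby mul1r.
pose lift (B : comPzRingType) (a : {rmorphism S -> B})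
  (ha : lc_valued_point (Y := wi_open) a) := wi_lift (svalP (inv B a ha)).
constructor; apply: (@LcLift _ _ _ wi_open (fun B a ha => sval (lift B a ha))).
  move=> B C c a a' ha ha' aE t.
  apply: (@wi_epi _ _ _ (sval (lift C a' ha')) (c \o sval (lift B a ha))) => s /=.
  by rewrite !(svalP (lift _ _ _)) aE.
by move=> B a ha x; exact: (svalP (lift B a ha)).
Qed.

(** The pieces are V(b) and D(b). On the first [b] becomes 0, with weak inverse 0; on the second it
    becomes invertible. *)
Lemma wi_cons_cov : cons_cov wi_hom.
Proof.
have idb : is_ideal (fun x : S => exists a, x = a * b).
  split; first by exists 0; rewrite mul0r.
    by move=> _ _ [u ->] [v ->]; exists (u + v); rewrite mulrDl.
  by move=> a _ [u ->]; exists (a * u); rewrite mulrA.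
have [Q [pi [pi_surj pi0]]] := ideal_quotient idb.
have pib : pi b = 0 by apply/pi0; exists 1; rewrite mul1r.
(* The open part is all of V(b), since the full set contains 1, which lies in no prime. *)
pose Yc := @LocClosed S Q pi pi_surj (fun _ => True).
exists bool, (fun i : bool => if i then wi_open else Yc); split; last first.
  case; first exact: wi_open_lift.
  have lift (B : comPzRingType) (a : {rmorphism Q -> B}) :
      {h : {rmorphism wi_ring b -> B} | forall s, h (wi_const b s) = (a \o pi) s}.
    apply: (@wi_lift _ _ _ _ 0) => /=; rewrite pib rmorph0.
    exact: weak_inverse00.
  constructor; apply: (@LcLift _ _ _ Yc (fun B a ha => sval (lift B a))).
    move=> B C c a a' _ _ aE t.
    apply: (@wi_epi _ _ _ (sval (lift C a')) (c \o sval (lift B a))) => s /=.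
    by rewrite !(svalP (lift _ _)) /= aE.
  by move=> B a _ x; exact: (svalP (lift B a)).
move=> p pp; have [idp p1 pM] := pp; have [pb|pb] := EM (p b).
- exists false; split; last first.
    by case=> // -[q [[_ [e [-> qe]]] pq]]; case: qe; exact: (pq b).1.
  have pker a : pi a = 0 -> p a by move=> /pi0 [u ->]; exact: pidealMr.
  have qE a : (exists2 a', pi a' = pi a & p a') <-> p a.
    split=> [[a' aa' pa']|pa]; last by exists a.
    rewrite -(subrK a' a); apply: pidealD => //; apply: pker.
    by rewrite rmorphB aa' subrr.
  exists (fun y => exists2 a, pi a = y & p a); split; last first.
    by move=> a; split=> /qE.
  split; last by exists 1; split=> //; rewrite -(rmorph1 pi) => /qE.
  split; first split.
  + by exists 0; [exact: rmorph0 | exact: pideal0].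
  + move=> _ _ [x <- px] [y <- py].
    by exists (x + y); [rewrite rmorphD | exact: pidealD].
  + move=> y _ [x <- px]; have [a <-] := pi_surj y.
    by exists (a * x); [rewrite rmorphM | exact: pidealMr].
  + by rewrite -(rmorph1 pi) => /qE.
  + move=> x y; have [[u <-] [v <-]] := (pi_surj x, pi_surj y).
    by rewrite -rmorphM !qE; exact: pM.
- exists true; split.
    by exists p; split=> //; split=> //; exists b.
  case=> // -[q [[[[q0 _ _] _ _] _] pq]]; case: pb; apply/pq; rewrite /= pib.
  exact: q0.
Qed.

End WeakInverseCover.

(** A prime [p] lies in some piece; a field at that point is a valued point of the piece, and the
    lift turns it into a morphism from [T] to the field whose kernel lies over [p]. *)
Lemma cons_surj_cov (R : comPzRingType) (S T : falg R) (f : falg_hom S T) :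
  cons_cov f -> surj_cov f.
Proof.
case=> I [Y [part lifts]] p pp.
have [i [[q [qY pq]] _]] := part p pp.
have [lift] := lifts i; have [qp [e [oe qe]]] := qY.
have [E [g gE]] := prime_field qp.
have hg : lc_valued_point g.
  move=> r rp; have [[r0 rD rM] r1 rP] := rp; split; first split.
  - split=> [|x y|a x]; first by rewrite rmorph0.
      by rewrite rmorphD; exact: rD.
    by rewrite rmorphM; exact: rM.
  - by rewrite rmorph1.
  - by move=> x y; rewrite rmorphM; exact: rP.
  exists e; split=> // rge; apply: r1.
  have ge0 : g e != 0 by apply/eqP => /gE.
  by rewrite -(mulVf ge0); exact: rM.
pose h := lc_lift_fun lift hg.
exists (fun t => h t = 0); split; first exact: kernel_prime.
by move=> a; rewrite (lc_lift_over lift hg); split=> [/pq/gE|/gE/pq].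
Qed.

(** * Maps from constructible functions to constructible sheaves *)

Section ConsUniversal.
Variables (R : comPzRingType) (G : presheaf R)
  (g : presheaf_hom (structure_presheaf R) G).
Hypothesis Gsheaf : is_sheaf (@cons_cov R) G.

Definition unit_at (S : falg R) : {rmorphism S -> G S} := g S.

Lemma unit_at_res (S T : falg R) (h : falg_hom S T) s :
  res G h (unit_at S s) = unit_at T (h s).
Proof. by rewrite -(phom_nat g h). Qed.

Lemma cons_res_inj (S T : falg R) (h : falg_hom S T) :
  cons_cov h -> injective (res G h).
Proof.
move=> ch x y xy; have [|z [_ zU]] := Gsheaf ch (x := res G h x).
  by move=> W a b ab; rewrite -!res_comp; apply: res_ext => s /=; exact: ab.
by rewrite -(zU x erefl) -(zU y (esym xy)).
Qed.

(* Weak inverses being unique, they satisfy descent. *)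
Definition descends (S T : falg R) (h : falg_hom S T) : Prop :=
  injective (res G h) /\
  forall y, (exists z, weak_inverse (res G h y) z) -> exists z, weak_inverse y z.

Lemma descends_id (S : falg R) : descends (falg_id S).
Proof.
by split=> [x y|y [z]]; rewrite !res_id // => yz; exists z.
Qed.

Lemma descends_comp (S T U : falg R) (k : falg_hom T U) (h : falg_hom S T) :
  descends h -> descends k -> descends (falg_comp k h).
Proof.
move=> [hI hW] [kI kW]; split=> [x y|y [z]]; rewrite !res_comp.
  by move=> /kI/hI.
by move=> yz; apply/hW/kW; exists z.
Qed.

(** The two restrictions of a weak inverse of [res G h y] are weak inverses of the same element,
    hence equal, so the weak inverse is a matching section. *)
Lemma descends_cons (S T : falg R) (h : falg_hom S T) : cons_cov h -> descends h.
Proof.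
move=> ch; split; first exact: cons_res_inj.
move=> y [z yz]; have [|z' [z'E _]] := Gsheaf ch (x := z).
  move=> W a b ab; apply: (@weak_inverse_unique _ (res G a (res G h y))).
    exact: weak_inverse_morph.
  have -> : res G a (res G h y) = res G b (res G h y).
    by rewrite -!res_comp; apply: res_ext => s /=; exact: ab.
  exact: weak_inverse_morph.
exists z'; case: yz; rewrite -z'E => y1 y2; split; apply: (cons_res_inj ch).
  by rewrite !rmorphM.
by rewrite !rmorphM.
Qed.

(** The default 0 is never taken on values of terms: the proof of [geval_local] finds a weak inverse
    of every [geval t]. *)
Definition ginv (S : falg R) (y : G S) : G S :=
  if pselect (exists z, weak_inverse y z) is left e then projT1 (cid e) else 0.

Lemma ginvP (S : falg R) (y : G S) :
  (exists z, weak_inverse y z) -> weak_inverse y (ginv y).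
Proof. by rewrite /ginv; case: pselect => // e _; exact: (projT2 (cid e)). Qed.

Definition geval (S : falg R) : iterm S -> G S := ieval (unit_at S) (@ginv S).

Lemma geval_inv_local (S T : falg R) (h : falg_hom S T) (y : G S) (s : T) :
  res G h y = unit_at T s ->
  exists z, weak_inverse (res G (falg_comp (wi_hom s) h) y) z.
Proof.
move=> yE; exists (unit_at (wi_falg s) (wi_elt s)); rewrite res_comp yE unit_at_res.
by apply: (weak_inverse_morph (unit_at (wi_falg s))); exact: wi_eltP.
Qed.

(** One element [s] represents [t] both in [G] and among constructible functions, so that vanishing
    in all fields can be transferred to [G]. The prior base change [k] allows two terms to be
    treated one after the other. *)
Definition locally_const (S : falg R) (t : iterm S) : Prop :=
  forall (S' : falg R) (k : falg_hom S S'),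
  exists (T : falg R) (h : falg_hom S' T) (s : T),
    [/\ descends h, res G (falg_comp h k) (geval t) = unit_at T s
      & cf_const T s = cf_map (falg_comp h k) (cf_mk t)].

Lemma geval_local2 (S : falg R) (t u : iterm S) :
  locally_const t -> locally_const u ->
  forall (S' : falg R) (k : falg_hom S S'),
  exists (T : falg R) (h : falg_hom S' T) (r s : T),
    [/\ descends h,
        res G (falg_comp h k) (geval t) = unit_at T r /\
          cf_const T r = cf_map (falg_comp h k) (cf_mk t)
      & res G (falg_comp h k) (geval u) = unit_at T s /\
          cf_const T s = cf_map (falg_comp h k) (cf_mk u)].
Proof.
move=> lt lu S' k; have [T [h [r [gh rE rC]]]] := lt S' k.
have [U [l [s [gl sE sC]]]] := lu T (falg_comp h k).
exists U, (falg_comp l h), (l r), s; split; first exact: descends_comp.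
  split; first by rewrite -unit_at_res -rE -res_comp; exact: res_ext.
  by rewrite -cf_map_const rC -cf_res_comp; exact: cf_res_ext.
split; first by rewrite -sE; exact: res_ext.
by rewrite sC; exact: cf_res_ext.
Qed.

Lemma geval_local (S : falg R) (t : iterm S) : locally_const t.
Proof.
elim: t => [s | t IHt | t IHt u IHu | t IHt u IHu | t IHt] S' k.
- exists S', (falg_id S'), (k s); split; first exact: descends_id.
    by rewrite /geval /= unit_at_res.
  by rewrite cf_map_mk /= /cf_const sem_constE.
- have [T [h [s [gh sE sC]]]] := IHt S' k; exists T, h, (- s); split=> //.
    by rewrite /geval /= !rmorphN sE.
  by rewrite /cf_mk sem_mkN !rmorphN -[sem_mk _ t]/(cf_mk t) sC.
- have [T [h [r [s [gh [rE rC] [sE sC]]]]]] := geval_local2 IHt IHu k.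
  exists T, h, (r + s); split=> //; rewrite ?/geval /= !rmorphD.
    by rewrite -rE -sE.
  by rewrite /cf_mk sem_mkD rmorphD rC sC.
- have [T [h [r [s [gh [rE rC] [sE sC]]]]]] := geval_local2 IHt IHu k.
  exists T, h, (r * s); split=> //; rewrite ?/geval /= !rmorphM.
    by rewrite -rE -sE.
  by rewrite /cf_mk sem_mkM rmorphM rC sC.
(* Over the covering that adjoins a weak inverse of [s], [geval t] restricts to the image of [s] and
   acquires a weak inverse, which descends to [S]. *)
have tw : weak_inverse (geval t) (ginv (geval t)).
  have [T [h [s [gh sE _]]]] := IHt S (falg_id S).
  have [_ H] := descends_comp gh (descends_cons (wi_cons_cov s)).
  apply/ginvP/H; apply: geval_inv_local.
  by rewrite -sE; apply: res_ext.
have [T [h [s [gh sE sC]]]] := IHt S' k.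
exists (wi_falg s), (falg_comp (wi_hom s) h), (wi_elt s); split.
- exact: (descends_comp gh (descends_cons (wi_cons_cov s))).
- apply: (@weak_inverse_unique _ (unit_at (wi_falg s) (wi_hom s s))).
    rewrite -unit_at_res -sE -res_comp.
    rewrite (@res_ext _ G _ _ _ (falg_comp (falg_comp (wi_hom s) h) k)) //.
    exact: weak_inverse_morph tw.
  by apply: (weak_inverse_morph (unit_at (wi_falg s))); exact: wi_eltP.
- apply: (@weak_inverse_unique _ (cf_const (wi_falg s) (wi_hom s s))).
    by apply: (weak_inverse_morph (cf_const (wi_falg s))); exact: wi_eltP.
  rewrite -cf_map_const sC -cf_res_comp.
  rewrite (@cf_res_ext _ _ _ _ (falg_comp (falg_comp (wi_hom s) h) k)) //.
  apply: weak_inverse_morph; rewrite [cf_mk (TInv t)]sem_mkV.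
  exact: cf_inv_weak.
Qed.

(** The difference becomes an element [s] of some [T] that vanishes in all fields, hence is
    nilpotent. Its image in [G] has a weak inverse by descent, so it is 0. *)
Lemma geval_sem (S : falg R) (t u : iterm S) :
  sem_eq (@field_model S) t u -> geval t = geval u.
Proof.
move=> tu; apply/eqP; rewrite -subr_eq0; apply/eqP.
have [T [h [s [[hI _] sE sC]]]] := geval_local (TAdd t (TOpp u)) (falg_id S).
have {}sC (L : fieldType) (f : {rmorphism T -> L}) : f s = 0.
  rewrite -cf_eval_const sC cf_eval_map cf_evalE /=.
  rewrite (tu L (f \o falg_comp h (falg_id S)) _ (FieldModel _)).
  by rewrite subrr.
have [n sn] := nilpotent_of_fields sC.
apply: hI; rewrite rmorph0.
have -> : res G h (geval t - geval u) = unit_at T s.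
  by rewrite -sE; apply: res_ext.
have [|z sz] := (descends_cons (wi_cons_cov s)).2 (unit_at T s).
  exists (unit_at (wi_falg s) (wi_elt s)); rewrite unit_at_res.
  by apply: (weak_inverse_morph (unit_at (wi_falg s))); exact: wi_eltP.
apply: (weak_inverse_nilpotent (n := n) sz).
by rewrite -rmorphXn sn rmorph0.
Qed.

Definition cf_to_at (S : falg R) : {rmorphism cfun S -> G S} :=
  sval (sem_eval (@geval_sem S)).

Lemma cf_to_atE (S : falg R) t : cf_to_at S (cf_mk t) = geval t.
Proof. exact: (svalP (sem_eval (@geval_sem S))). Qed.

Lemma cf_to_at_const (S : falg R) s : cf_to_at S (cf_const S s) = unit_at S s.
Proof. by rewrite [cf_const S s]sem_constE cf_to_atE. Qed.

Fact cf_to_nat (S T : falg R) (h : falg_hom S T) x :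
  cf_to_at T (cf_map h x) = res G h (cf_to_at S x).
Proof.
apply: (@cf_ringmorph_unique _ _ (cf_to_at T \o cf_map h) (res G h \o cf_to_at S)).
by move=> s /=; rewrite cf_map_const !cf_to_at_const unit_at_res.
Qed.

Definition cf_to : presheaf_hom (cf_presheaf R) G :=
  @PresheafHom R (cf_presheaf R) G cf_to_at cf_to_nat.

Lemma cf_toP : factors_through (cf_eta R) g cf_to.
Proof. by move=> S x; exact: cf_to_at_const. Qed.

End ConsUniversal.

(** * Generic extension of morphisms to fields *)

Lemma ex_minimal (T : Type) (Q : T -> Prop) (m : T -> nat) :
  (exists x, Q x) -> exists x, Q x /\ forall y, Q y -> (m x <= m y)%N.
Proof.
move=> [x0 Qx0].
have ex : exists n, `[< exists x, Q x /\ m x = n >].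
  by exists (m x0); apply/asboolP; exists x0.
case: (ex_minnP ex) => n /asboolP [x [Qx <-]] min; exists x; split=> // y Qy.
by apply: min; apply/asboolP; exists y.
Qed.

(** A nonconstant factor of least degree is irreducible, and a root of it can be adjoined. *)
Lemma root_extension (L : fieldType) (P : {poly L}) : (1 < size P)%N ->
  exists (L' : fieldType) (i : {rmorphism L -> L'}) (z : L'),
    root (map_poly i P) z.
Proof.
move=> sP.
have [|D [[DP sD] minD]] := @ex_minimal _
  (fun D : {poly L} => D %| P /\ (1 < size D)%N) (fun D => size D).
  by exists P.
have D0 : D != 0 by rewrite -size_poly_gt0 ltnW.
have irrD : irreducible_poly D.
  split=> // q sq qD; rewrite -dvdp_size_eqp // eqn_leq dvdp_leq //=.
  apply: minD; split; first exact: dvdp_trans qD DP.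
  have : q != 0 by apply: contraNneq D0 => q0; rewrite q0 dvd0p in qD.
  by rewrite -size_poly_gt0; case: (size q) sq => [|[]].
have [L' _ [z rz _]] := irredp_FAdjoin irrD.
exists L', (in_alg L'), z.
by apply: root_dvdp rz; rewrite dvdp_map.
Qed.

Section OneVariable.
Variables (A : comNzRingType) (E : fieldType) (f : {rmorphism A -> E}) (x : E).
Let g : {rmorphism {poly A} -> E} := eval_morph f x.

(** Truncation discards the top coefficients killed by [f]; if the image is nonzero, the new leading
    coefficient stays nonzero in [E], as pseudo-division needs. *)
Lemma strip_poly (P : {poly A}) : exists P' : {poly A},
  map_poly f P' = map_poly f P /\ size P' = size (map_poly f P).
Proof.
pose P' := \poly_(i < size (map_poly f P)) P`_i.
have mE : map_poly f P' = map_poly f P.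
  apply/polyP => i; rewrite !coef_map coef_poly.
  by case: ltnP => // si; rewrite raddf0 -coef_map nth_default.
exists P'; split=> //; apply/eqP; rewrite eqn_leq size_poly -mE.
exact: size_poly.
Qed.

Lemma strip_lead (P : {poly A}) : map_poly f P != 0 ->
  size P = size (map_poly f P) -> f (lead_coef P) != 0.
Proof.
move=> P0 sP; have : lead_coef (map_poly f P) != 0 by rewrite lead_coef_eq0.
by rewrite !lead_coefE coef_map /= -sP.
Qed.

Section OtherField.
Variables (L : fieldType) (h : {rmorphism A -> L}).
Hypothesis fh : forall a, f a = 0 -> h a = 0.

Lemma map_poly_kernel P : map_poly f P = 0 -> map_poly h P = 0.
Proof.
move=> fP; apply/polyP => i; rewrite coef_map coef0; apply: fh.
by rewrite -coef_map fP coef0.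
Qed.
End OtherField.

(* Degrees are measured in E[X], as [f] need not be injective. *)
Definition min_relation (M : {poly A}) : Prop :=
  [/\ g M = 0, map_poly f M != 0, size M = size (map_poly f M) &
    forall P, g P = 0 -> map_poly f P != 0 -> (size M <= size (map_poly f P))%N].

Lemma min_relationP :
  (exists M, min_relation M) \/ forall P, g P = 0 -> map_poly f P = 0.
Proof.
have [ex|nex] := EM (exists P, g P = 0 /\ map_poly f P != 0).
  left; have [P [[gP P0] minP]] :=
    @ex_minimal _ _ (fun P => size (map_poly f P)) ex.
  have [M [mM sM]] := strip_poly P.
  exists M; split; rewrite ?mM //; first by rewrite /g eval_morphE mM -eval_morphE.
  by move=> Q gQ Q0; rewrite sM; exact: minP.
by right=> P gP; apply: contrapT => /eqP P0; apply: nex; exists P.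
Qed.

Lemma pseudo_division (P D : {poly A}) : map_poly f D != 0 ->
  size D = size (map_poly f D) ->
  exists (k : nat) (Q Rm : {poly A}),
    lead_coef D ^+ k *: P = Q * D + Rm /\ (size (map_poly f Rm) < size D)%N.
Proof.
move=> D0 sD; exists (Pdiv.CommonRing.rscalp P D),
  (Pdiv.CommonRing.rdivp P D), (Pdiv.CommonRing.rmodp P D).
split; first exact: Pdiv.ComRing.rdivp_eq.
rewrite (leq_ltn_trans (size_poly _ _)) // Pdiv.CommonRing.ltn_rmodpN0 //.
by apply: contra_neq D0 => ->; rewrite rmorph0.
Qed.

Lemma gZ a P : g (a *: P) = f a * g P.
Proof. by rewrite -mul_polyC rmorphM /= eval_morphC. Qed.

Section Algebraic.
Variables (M : {poly A}) (minM : min_relation M).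

(** The pseudo-remainder of [P] by [M] vanishes at [x] and has smaller degree than [M], so its
    coefficients are killed by [f] and hence by [h]. At [z] only a power of the leading coefficient
    times [P] remains. *)
Lemma min_relation_kernel (L : fieldType) (h : {rmorphism A -> L}) (z : L) :
  (forall a, f a = 0 -> h a = 0) -> h (lead_coef M) != 0 ->
  root (map_poly h M) z -> forall P, g P = 0 -> eval_morph h z P = 0.
Proof.
case: minM => gM M0 sM min fh hM /eqP rz P gP.
have [k [Q [N [PE sN]]]] := pseudo_division P M0 sM.
have gN : g N = 0.
  have := congr1 g PE; rewrite rmorphD rmorphM gM mulr0 add0r gZ gP mulr0.
  by [].
have N0 : map_poly f N = 0.
  apply: contrapT => /eqP N0; have := min N gN N0.
  by rewrite leqNgt sN.
have := congr1 (eval_morph h z) PE.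
rewrite -mul_polyC !rmorphM rmorphD rmorphM /= eval_morphC rmorphXn.
rewrite (eval_morphE h z M) rz mulr0 add0r (eval_morphE h z N).
rewrite (map_poly_kernel fh N0) horner0 => /eqP.
by rewrite mulf_eq0 expf_eq0 (negPf hM) andbF => /eqP.
Qed.

(** This clears denominators in the inverse of [g u]. Let [N] have least degree over [E] among
    polynomials whose value is nonzero and a multiple of [g u]. The pseudo-remainder of [M] by [N]
    vanishes at [x], hence over [E], so [N] divides a multiple of [M] by a nonzero constant. *)
Lemma min_relation_bezout (u : {poly A}) : g u != 0 ->
  exists (c : A) (W : {poly A}), f c != 0 /\ f c = g u * g W.
Proof.
case: minM => gM M0 sM min gu.
pose multiple (N : {poly A}) := g N != 0 /\ exists W, g N = g u * g W.
have [|N0 [[gN0 [W gW]] minN0]] :=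
    @ex_minimal _ multiple (fun N => size (map_poly f N)).
  by exists u; split=> //; exists 1; rewrite rmorph1 mulr1.
have [N [mN sN]] := strip_poly N0.
have gNE : g N = g N0 by rewrite /g !eval_morphE mN.
have {}minN P : multiple P -> (size N <= size (map_poly f P))%N.
  by rewrite sN; exact: minN0.
have {}gN0 : g N != 0 by rewrite gNE.
have {}gW : g N = g u * g W by rewrite gNE.
have {}sN : size N = size (map_poly f N) by rewrite mN.
have fN0 : map_poly f N != 0.
  by apply: contra_neq gN0 => N00; rewrite /g eval_morphE N00 horner0.
have NM : (size N < size M)%N.
  have [k [Q [P [PE sP]]]] := pseudo_division N M0 sM.
  have gP : g P = f (lead_coef M) ^+ k * g N.
    have := congr1 g PE; rewrite rmorphD rmorphM gM mulr0 add0r gZ rmorphXn.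
    by move->.
  apply: leq_ltn_trans (minN P _) sP; split.
    by rewrite gP mulf_neq0 // expf_neq0 // strip_lead.
  by exists ((lead_coef M ^+ k) *: W); rewrite gP gW gZ rmorphXn mulrCA.
have [k [Q [P [PE sP]]]] := pseudo_division M fN0 sN.
have gPE : g P = g N * - g Q.
  have := congr1 g PE; rewrite rmorphD rmorphM gZ gM mulr0 => /esym/eqP.
  by rewrite addrC addr_eq0 => /eqP ->; rewrite mulrN mulrC.
have gP : g P = 0.
  apply: contrapT => /eqP gP.
  have : multiple P.
    by split=> //; exists (- (W * Q)); rewrite gPE gW rmorphN rmorphM !mulrN mulrA.
  by move=> /minN; rewrite leqNgt sP.
have gQ : g Q = 0.
  move/eqP: gPE; rewrite gP eq_sym mulf_eq0 (negPf gN0) oppr_eq0 /=.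
  by move/eqP.
have P0 : map_poly f P = 0.
  apply: contrapT => /eqP P0; have := min P gP P0.
  by rewrite leqNgt (ltn_trans sP NM).
have fE : f (lead_coef N) ^+ k *: map_poly f M = map_poly f Q * map_poly f N.
  have := congr1 (map_poly f) PE; rewrite rmorphD rmorphM /= P0 addr0.
  by rewrite map_polyZ rmorphXn.
have lN : f (lead_coef N) ^+ k != 0 by rewrite expf_neq0 // strip_lead.
have Q0 : map_poly f Q != 0.
  apply: contra_neq M0 => Q0; apply/eqP; move/eqP: fE.
  by rewrite Q0 mul0r scaler_eq0 (negPf lN).
(* The cofactor [Q] vanishes at [x], so its degree is at least that of [M], which leaves degree 0
   for [N]. *)
have sNle : (size N <= 1)%N.
  have := congr1 (fun p : {poly E} => size p) fE.
  rewrite /= size_scale // size_mul // -sM -sN => sE.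
  have := min Q gQ Q0; rewrite sE.
  case: (size N) => [//|n]; rewrite addnS /= => H.
  by rewrite ltnS -(leq_add2l (size (map_poly f Q))) addn0.
have NE := size1_polyC sNle.
exists N`_0, W; have fN : f N`_0 = g N by rewrite {2}NE /g eval_morphC.
by rewrite fN gW; split=> //; rewrite -gW.
Qed.

Lemma algebraic_extension (u : {poly A}) : g u != 0 ->
  exists b, f b != 0 /\
    forall (L : fieldType) (h : {rmorphism A -> L}) (z : L),
      (forall a, f a = 0 -> h a = 0) -> h b != 0 -> root (map_poly h M) z ->
      (forall P, g P = 0 -> eval_morph h z P = 0) /\ eval_morph h z u != 0.
Proof.
move=> gu; have [c [W [fc cE]]] := min_relation_bezout gu.
have [gM M0 sM _] := minM.
(* The first factor permits pseudo-division by [M] over [L]; the second is a multiple of [u] modulo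
   the kernel of [g] and keeps [u] nonzero. *)
exists (lead_coef M * c); split; first by rewrite rmorphM mulf_neq0 // strip_lead.
move=> L h z fh; rewrite rmorphM mulf_eq0 negb_or => /andP [hM hc] rz.
have ker := min_relation_kernel fh hM rz; split=> //.
have : g (c%:P - u * W) = 0.
  by rewrite rmorphB rmorphM /= [g c%:P]eval_morphC cE subrr.
move/ker; rewrite rmorphB rmorphM /= eval_morphC => /eqP.
rewrite subr_eq0 => /eqP hcE.
by apply: contra_neq hc => hu; rewrite hcE hu mul0r.
Qed.

End Algebraic.

(** Here [L'] is the rational function field over [L] and [z] its variable; [b] is the coefficient
    of [u] that leads over [E]. Being outside [L], [z] serves to separate values. *)
Lemma transcendental_extension (u : {poly A}) :
  (forall P, g P = 0 -> map_poly f P = 0) -> g u != 0 ->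
  exists b, f b != 0 /\
    forall (L : fieldType) (h : {rmorphism A -> L}),
      (forall a, f a = 0 -> h a = 0) -> h b != 0 ->
      exists (L' : fieldType) (i : {rmorphism L -> L'}) (z : L'),
        [/\ forall y, z != i y,
            forall P, g P = 0 -> eval_morph (i \o h) z P = 0 &
            eval_morph (i \o h) z u != 0].
Proof.
move=> trans gu.
have fu : map_poly f u != 0.
  by apply: contra_neq gu => u0; rewrite /g eval_morphE u0 horner0.
exists u`_(size (map_poly f u)).-1; split.
  by rewrite -coef_map -lead_coefE lead_coef_eq0.
move=> L h fh hb.
have hu : map_poly h u != 0.
  by apply: contra_neq hb => hu; rewrite -coef_map hu coef0.
pose j : {rmorphism {poly L} -> {fraction {poly L}}} := @tofrac {poly L}.
pose i : {rmorphism L -> {fraction {poly L}}} := j \o polyC.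
have iE P : eval_morph (i \o h) (j 'X) P = j (map_poly h P).
  rewrite eval_morphE (map_poly_comp i h) (map_poly_comp j polyC).
  by rewrite [LHS](horner_map j) -[_.['X]]/(_ \Po 'X) comp_polyXr.
exists {fraction {poly L}}, i, (j 'X); split.
- move=> y; rewrite -subr_eq0 -[i y]/(j y%:P) -rmorphB.
  by rewrite [_ == 0]tofrac_eq0 polyXsubC_eq0.
- by move=> P gP; rewrite iE (map_poly_kernel fh (trans P gP)) rmorph0.
- by rewrite iE [_ == 0]tofrac_eq0.
Qed.

Lemma one_variable_extension (u : {poly A}) : g u != 0 ->
  exists b, f b != 0 /\
    forall (L : fieldType) (h : {rmorphism A -> L}),
      (forall a, f a = 0 -> h a = 0) -> h b != 0 ->
      exists (L' : fieldType) (i : {rmorphism L -> L'}) (z : L'),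
        (forall P, g P = 0 -> eval_morph (i \o h) z P = 0) /\
        eval_morph (i \o h) z u != 0.
Proof.
move=> gu; have [[M minM]|trans] := min_relationP; last first.
  have [b [fb bP]] := transcendental_extension trans gu.
  exists b; split=> // L h fh /(bP L h fh) [L' [i [z [_ zP zu]]]].
  by exists L', i, z.
have [b [fb bP]] := algebraic_extension minM gu.
have [gM M0 sM _] := minM; have fm := strip_lead M0 sM.
(* A nonzero leading coefficient keeps the image of [M] nonconstant over [L], so that it has a root
   in an extension. *)
exists (lead_coef M * b); split; first by rewrite rmorphM mulf_neq0.
move=> L h fh; rewrite rmorphM mulf_eq0 negb_or => /andP [hm hb].
have sM1 : (1 < size M)%N.
  rewrite ltnNge; apply/negP => /size1_polyC; move: (M`_0) => c ME.
  move: gM fm; rewrite ME lead_coefC [g _]eval_morphC => ->.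
  by rewrite eqxx.
have [|L' [i [z rz]]] := @root_extension L (map_poly h M).
  by rewrite size_map_poly_id0.
exists L', i, z; apply: bP.
- by move=> a /fh ha; rewrite /= ha rmorph0.
- by rewrite /= fmorph_eq0.
- by rewrite map_poly_comp.
Qed.

End OneVariable.

(* Atiyah-Macdonald, Proposition 5.23, for the domains [A/ker (k f)] and
   [C/ker k], with an extension [L'] instead of an algebraically closed [L]. *)
Lemma generic_extension (n : nat) (A C : comNzRingType) (f : {rmorphism A -> C})
    (s : seq C) (E : fieldType) (k : {rmorphism C -> E}) (u : C) :
  size s = n -> generated f s -> k u != 0 ->
  exists b, k (f b) != 0 /\
    forall (L : fieldType) (h : {rmorphism A -> L}),
      (forall a, k (f a) = 0 -> h a = 0) -> h b != 0 ->
      exists (L' : fieldType) (i : {rmorphism L -> L'}) (l : {rmorphism C -> L'}),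
        [/\ forall a, l (f a) = i (h a), forall c, k c = 0 -> l c = 0 & l u != 0].
Proof.
elim: n A f s => [|n IHn] A f [|x s] //= ss gen ku.
  have fs := generated_nil gen; have [b bu] := fs u; exists b.
  rewrite bu; split=> // L h kh hb.
  have [r rK] := choice fs.
  have hE a a' : f a = f a' -> h a = h a'.
    move=> aa; apply/eqP; rewrite -subr_eq0 -rmorphB; apply/eqP/kh.
    by rewrite rmorphB aa subrr rmorph0.
  have [|c d|c d|l lE] := @rmorph_of_fun C L (h \o r).
  - by rewrite /= -(rmorph1 h); apply: hE; rewrite rK rmorph1.
  - by rewrite /= -rmorphD; apply: hE; rewrite rmorphD !rK.
  - by rewrite /= -rmorphM; apply: hE; rewrite rmorphM !rK.
  exists L, idfun, l; split.
  - by move=> a; rewrite lE /=; apply: hE; rewrite rK.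
  - by move=> c kc; rewrite lE /=; apply: kh; rewrite rK.
  - by rewrite lE /= (hE _ b) // rK bu.
(* Over [{poly A}] the remaining generators suffice and reduce [u] to a polynomial [b1] that must
   not vanish at the value of X; the case of one variable then reduces [b1] to an element [b] of
   [A]. *)
case: ss => /IHn; move/(_ _ _ (generated_cons gen) ku) => [b1 [kb1 b1P]].
have kE P : k (eval_morph f x P) = eval_morph (k \o f) (k x) P.
  rewrite !eval_morphE (map_poly_comp k f); exact: esym (horner_map k _ _).
have [|b [kb bP]] := @one_variable_extension _ _ (k \o f) (k x) b1.
  by rewrite -kE.
exists b; split=> // L h kh hb.
have [L1 [i1 [z [zker zb1]]]] := bP L h kh hb.
have [|L2 [i2 [l [lE lker lu]]]] := b1P L1 (eval_morph (i1 \o h) z) _ zb1.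
  by move=> P; rewrite kE; exact: zker.
exists L2, (i2 \o i1), l; split=> // a.
by rewrite -(eval_morphC f x) lE eval_morphC.
Qed.

(** * Descent of values in characteristic zero *)

(** In characteristic 0 the derivative of a nonconstant polynomial is nonzero and of smaller degree,
    so by minimality it does not vanish at [w]. *)
Lemma simple_root_of_min (A : comNzRingType) (E : fieldType)
    (f : {rmorphism A -> E}) (w : E) (M : {poly A}) :
  [pchar E] =i pred0 -> min_relation f w M ->
  ((map_poly f M)^`()).[w] != 0.
Proof.
move=> /pcharf0P char0 [gM M0 sM min]; apply/eqP => dM.
have sM0 : (0 < size (map_poly f M))%N by rewrite size_poly_gt0.
have sM1 : (1 < size (map_poly f M))%N.
  apply: (@root_size_gt1 _ w) => //; apply/eqP.
  by rewrite -eval_morphE.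
have d0 : map_poly f M^`() != 0.
  rewrite -deriv_map; apply/eqP.
  move=> /(congr1 (fun p : {poly E} => p`_(size (map_poly f M)).-2)).
  rewrite coef_deriv coef0 prednK -?subn1 ?subn_gt0 // subn1 -lead_coefE.
  move/eqP; rewrite -mulr_natr mulf_eq0 lead_coef_eq0 (negPf M0) char0.
  by rewrite -subn1 subn_eq0 leqNgt sM1.
have := min M^`() _ d0; rewrite eval_morphE -deriv_map => /(_ dM).
by rewrite sM leqNgt lt_size_deriv.
Qed.

(** If [w] is transcendental, a new variable works. Otherwise X - w divides the minimal relation
    exactly once; the cofactor [N] is nonconstant, since a linear relation would make [w] a
    fraction, and a root of [N] is a conjugate distinct from [w]. *)
Lemma separate_value (A : comNzRingType) (E : fieldType)
    (f : {rmorphism A -> E}) (w : E) (u : {poly A}) :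
  [pchar E] =i pred0 -> eval_morph f w u != 0 ->
  (forall a c, f c != 0 -> w * f c <> f a) ->
  exists (L : fieldType) (i : {rmorphism E -> L}) (z : L),
    [/\ z != i w, forall P, eval_morph f w P = 0 -> eval_morph (i \o f) z P = 0
      & eval_morph (i \o f) z u != 0].
Proof.
move=> char0 gu nfrac; have [[M minM]|trans] := min_relationP f w; last first.
  have [b [fb bP]] := transcendental_extension trans gu.
  have [L [i [z [zi zker zu]]]] := bP E f (fun a fa => fa) fb.
  by exists L, i, z.
have [gM M0 sM _] := minM; have fm := strip_lead M0 sM.
have /factor_theorem [N NE] : root (map_poly f M) w by apply/eqP; rewrite -eval_morphE.
have N0 : N != 0 by apply: contra_neq M0 => N0; rewrite NE N0 mul0r.
have Nw : N.[w] != 0.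
  have := simple_root_of_min char0 minM.
  rewrite NE derivM derivXsubC mulr1 hornerD hornerM hornerXsubC.
  by rewrite subrr mulr0 add0r.
have sN : size (map_poly f M) = (size N).+1.
  by rewrite NE size_Mmonic ?monicXsubC // size_XsubC addn2.
have sN1 : (1 < size N)%N.
  rewrite ltnNge; apply/negP => sN1.
  have {}sM : (size M <= 2)%N by rewrite sM sN.
  have ME : M = M`_1 *: 'X + (M`_0)%:P.
    apply/polyP => -[|[|i]]; rewrite coefD coefZ coefX coefC /=
      ?mulr0 ?mulr1 ?add0r ?addr0 //.
    by rewrite nth_default // (leq_trans sM).
  have sM2 : size M = 2.
    apply/eqP; rewrite eqn_leq sM /=; case: minM => _ _ -> _; rewrite sN ltnS.
    by rewrite size_poly_gt0.
  have m1 : f M`_1 != 0 by move: fm; rewrite lead_coefE sM2.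
  apply: (nfrac (- M`_0) M`_1 m1).
  apply/eqP; rewrite rmorphN -addr_eq0; apply/eqP; move: gM.
  rewrite {1}ME rmorphD /= eval_morphC -mul_polyC rmorphM /= eval_morphC.
  by rewrite eval_morphX mulrC.
have [L [i [z rz]]] := root_extension sN1.
have [b [fb bP]] := algebraic_extension minM gu.
have [|||zker zu] := bP L (i \o f) z.
- by move=> a fa; rewrite /= fa rmorph0.
- by rewrite /= fmorph_eq0.
- by rewrite map_poly_comp; apply: root_dvdp rz; rewrite dvdp_map NE dvdp_mulr.
exists L, i, z; split=> //; apply: contraNneq Nw => zw.
by move: rz; rewrite zw /root (horner_map i) fmorph_eq0.
Qed.

Lemma generated_map_poly (S T : comNzRingType) (f : {rmorphism S -> T}) s :
  generated f s -> generated (map_poly f) (map polyC s).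
Proof.
move=> gen P Pf Ps PD PM; elim/poly_ind => [|p c Pp].
  by rewrite -(rmorph0 (map_poly f)); exact: Pf.
apply: (PD); first by apply: (PM) => //; rewrite -(map_polyX f); exact: Pf.
apply: (gen (fun c => P c%:P)) => [r|x xs|x y|x y].
- by rewrite -map_polyC; exact: Pf.
- by apply: Ps; rewrite map_f.
- by rewrite polyCD; exact: PD.
- by rewrite polyCM; exact: PM.
Qed.

(* Specializations separating [k t / k u] extend to [T], one after the other,
   until both have values in the same field. *)
Lemma value_fractional (S T : comNzRingType) (f : {rmorphism S -> T}) (s : seq T)
    (E : fieldType) (k : {rmorphism T -> E}) (t u : T) :
  generated f s -> [pchar E] =i pred0 -> k u != 0 ->
  (forall (L : fieldType) (l m : {rmorphism T -> L}),
     (forall a, l (f a) = m (f a)) ->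
     (forall c, k c = 0 -> l c = 0) -> (forall c, k c = 0 -> m c = 0) ->
     l u != 0 -> m u != 0 -> l t / l u = m t / m u) ->
  exists a c : S, k (f c) != 0 /\ k t * k (f c) = k u * k (f a).
Proof.
move=> gen char0 ku agree; apply: contrapT => nex.
(* The extra variable X, sent to [w] by [g], represents t/u, so that a specialization of S[X]
   prescribes the value of this fraction. *)
pose w := k t / k u; pose g := eval_morph k w.
pose F : {rmorphism {poly S} -> {poly T}} := map_poly f.
have gF P : g (F P) = eval_morph (k \o f) w P.
  by rewrite /g !eval_morphE (map_poly_comp k f).
have gu : g u%:P != 0 by rewrite [g _]eval_morphC.
have [b [gb bP]] := generic_extension erefl (generated_map_poly gen) gu.
have [||L [i [z [zw zker zb]]]] := @separate_value S E (k \o f) w b char0.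
- by rewrite -gF.
- move=> a c /= fc wE; apply: nex; exists a, c; split=> //.
  by rewrite -wE mulrA /w mulrCA mulfV // mulr1.
have [|L2 [i2 [l2 [l2E l2ker l2u]]]] := bP L (eval_morph ((i \o k) \o f) z) _ zb.
  by move=> P; rewrite gF; exact: zker.
(* The specialization sending X to [w] is extended over [L2], the field that received the one
   sending X to [z]; both morphisms then land in [L3] and agree on [S]. *)
have [||L3 [i3 [l3 [l3E l3ker l3u]]]] :=
    bP L2 (i2 \o i \o (eval_morph (k \o f) w)).
- by move=> P; rewrite gF /= => ->; rewrite !rmorph0.
- by rewrite -[X in X != 0]/(i2 (i (eval_morph (k \o f) w b))) !fmorph_eq0 -gF.
(* As [u%:P * 'X - t%:P] is in the kernel of [g], the fraction t/u takes the value of X, which is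
   the image of [z] in one case and of [w] in the other. *)
have key (L' : fieldType) (l : {rmorphism {poly T} -> L'}) :
    (forall c, g c = 0 -> l c = 0) -> l u%:P != 0 -> l t%:P / l u%:P = l 'X.
  move=> lker lu; have : g (u%:P * 'X - t%:P) = 0.
    rewrite rmorphB rmorphM /= [g 'X]eval_morphX ![g _%:P]eval_morphC.
    by rewrite /w mulrCA mulfV // mulr1 subrr.
  move/lker/eqP; rewrite rmorphB rmorphM subr_eq0 => /eqP <-.
  by rewrite mulrC mulKf.
have kerC (L' : fieldType) (l : {rmorphism {poly T} -> L'}) :
    (forall c, g c = 0 -> l c = 0) -> forall c, k c = 0 -> l c%:P = 0.
  by move=> lker c kc; apply: lker; rewrite [g _]eval_morphC.
have FC a : (f a)%:P = F a%:P by rewrite [F _]map_polyC.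
have FX : 'X = F 'X by rewrite [F _]map_polyX.
have : i3 (l2 t%:P) / i3 (l2 u%:P) = l3 t%:P / l3 u%:P.
  apply: (agree L3 (i3 \o l2 \o polyC) (l3 \o polyC)) => //=.
  - by move=> a; rewrite FC l2E l3E /= !eval_morphC.
  - by move=> c kc; rewrite (kerC _ l2) // rmorph0.
  - exact: kerC.
  - by rewrite fmorph_eq0.
rewrite -fmorph_div key // key // FX l2E l3E !eval_morphX /= eval_morphX.
by move/fmorph_inj/fmorph_inj => zE; rewrite zE eqxx in zw.
Qed.

(** * Constructible functions form a sheaf for the surjective topology *)

Lemma subring_of (L : comPzRingType) (D : L -> Prop) :
  D 1 -> (forall x y, D x -> D y -> D (x - y)) ->
  (forall x y, D x -> D y -> D (x * y)) ->
  exists (W : comPzRingType) (v : {rmorphism W -> L}),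
    injective v /\ forall y, D y <-> exists w, v w = y.
Proof.
move=> D1 DB DM; pose d : {pred L} := fun y => `[< D y >].
have dP y : reflect (D y) (y \in d) by exact: asboolP.
have dC : subring_closed d.
  split=> [|x y /dP Dx /dP Dy|x y /dP Dx /dP Dy]; apply/dP => //.
    exact: DB.
  exact: DM.
pose U : subChoiceType (fun y => y \in d) := {y : L | y \in d}.
pose W : comPzRingType := HB.pack (U : Type) (SubChoice.class U)
  (GRing.SubChoice_isSubComPzRing.Build L d U dC).
have [|||v vE] := @rmorph_of_fun W L (fun w : U => val w) => //.
exists W, v; split=> [w w'|y]; first by rewrite !vE => /val_inj.
split=> [/dP Dy|[w <-]]; first by exists (exist _ y Dy); rewrite vE.
by rewrite vE; apply/dP; exact: (svalP (w : U)).
Qed.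

Lemma rmorph_lift (A W L : comPzRingType) (v : {rmorphism W -> L})
    (l : {rmorphism A -> L}) :
  injective v -> (forall a, exists w, v w = l a) ->
  exists a : {rmorphism A -> W}, forall x, v (a x) = l x.
Proof.
move=> vI /choice [r rE].
have [|x y|x y|h hE] := @rmorph_of_fun A W r.
- by apply: vI; rewrite rE !rmorph1.
- by apply: vI; rewrite rmorphD !rE rmorphD.
- by apply: vI; rewrite rmorphM !rE rmorphM.
by exists h => x; rewrite hE rE.
Qed.

(** The matching condition only speaks of finitely generated algebras, so [L] is replaced by its
    subring generated by the images of [l] and [m]. *)
Lemma matching_fields (R : comPzRingType) (S T : falg R) (f : falg_hom S T)
    (x : cfun T) :
  matching (F := cf_presheaf R) f x ->
  forall (L : fieldType) (l m : {rmorphism T -> L}),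
    (forall s, l (f s) = m (f s)) -> cf_eval l x = cf_eval m x.
Proof.
move=> match_x L l m lm.
pose D (y : L) := forall P : L -> Prop, (forall t, P (l t)) ->
  (forall t, P (m t)) -> (forall y z, P y -> P z -> P (y + z)) ->
  (forall y z, P y -> P z -> P (y * z)) -> P y.
have Dl t : D (l t) by move=> P Pl _ _ _; exact: Pl.
have Dm t : D (m t) by move=> P _ Pm _ _; exact: Pm.
have DD y z : D y -> D z -> D (y + z).
  by move=> Dy Dz P Pl Pm PD PM; apply: (PD); [exact: Dy | exact: Dz].
have DM y z : D y -> D z -> D (y * z).
  by move=> Dy Dz P Pl Pm PD PM; apply: (PM); [exact: Dy | exact: Dz].
have [||//|W [v [vI vD]]] := @subring_of L D.
- by rewrite -(rmorph1 l).
- move=> y z Dy Dz; apply: DD => //.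
  by rewrite -mulN1r -(rmorph1 l) -rmorphN; exact: DM.
have [a aE] := rmorph_lift vI (fun t => (vD _).1 (Dl t)).
have [b bE] := rmorph_lift vI (fun t => (vD _).1 (Dm t)).
have ab s : a (f s) = b (f s) by apply: vI; rewrite aE bE.
have Wfg : finitely_generated (a \o falg_str T).
  have [s gen] := falg_fg T; exists (map a s ++ map b s) => P Pr Ps PD PM w.
  have aP t : P (a t).
    apply: (gen (fun t => P (a t))) => [r|z zs|y z|y z].
    - exact: Pr.
    - by apply: Ps; rewrite mem_cat map_f.
    - by rewrite rmorphD; exact: PD.
    - by rewrite rmorphM; exact: PM.
  have bP t : P (b t).
    apply: (gen (fun t => P (b t))) => [r|z zs|y z|y z].
    (* Scalars pass through [S], where [a] and [b] agree. *)
    - by rewrite -(hom_str f) -ab (hom_str f); exact: Pr.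
    - by apply: Ps; rewrite mem_cat map_f ?orbT.
    - by rewrite rmorphD; exact: PD.
    - by rewrite rmorphM; exact: PM.
  have : D (v w) by apply/vD; exists w.
  move=> /(_ (fun y => exists2 w, v w = y & P w))
    [t|t|_ _ [y <- Py] [z <- Pz]|_ _ [y <- Py] [z <- Pz]|w' /vI -> //].
  - by exists (a t).
  - by exists (b t).
  - by exists (y + z); [rewrite rmorphD | exact: PD].
  - by exists (y * z); [rewrite rmorphM | exact: PM].
pose Wf : falg R := FAlg Wfg.
pose ha : falg_hom T Wf := @FAlgHom R T Wf a (fun r => erefl).
have bstr r : (b : {rmorphism T -> Wf}) (falg_str T r) = falg_str Wf r.
  by rewrite /= -(hom_str f) -ab.
pose hb : falg_hom T Wf := @FAlgHom R T Wf b bstr.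
have xE : cf_map a x = cf_map b x := match_x Wf ha hb ab.
rewrite -(eq_cf_eval (f := v \o a)) // -cf_eval_map xE cf_eval_map.
exact: eq_cf_eval.
Qed.

Lemma char0_field_over (R : comPzRingType) (E : fieldType)
    (k : {rmorphism R -> E}) :
  contains_char0_field R -> [pchar E] =i pred0.
Proof. by move=> [K [i [_ charK]]] p; rewrite (fmorph_pchar (k \o i)) charK. Qed.

Section Gluing.
Variables (R : comPzRingType) (R_char0 : contains_char0_field R).
Variables (S T : falg R) (f : falg_hom S T) (f_surj : surj_cov f).
Variables (x : cfun T) (match_x : matching (F := cf_presheaf R) f x).

Lemma falg_hom_generated : exists s, generated f s.
Proof.
have [s gen] := falg_fg T; exists s => P Pf Ps PD PM; apply: gen => // r.
by rewrite -(hom_str f).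
Qed.

(** At a prime [q] over [p], [x] is a fraction t/u, equal to some a/c from [S]. Under the
    nonvanishing conditions on V(p), each [l] agrees on [S], after extending the field, with some
    [m] that kills [q] and keeps [u] nonzero; matching carries the value from [m] to [l]. *)
Lemma local_value (p : S -> Prop) : is_prime p ->
  exists a b : S, ~ p b /\
    forall (L : fieldType) (l : {rmorphism T -> L}),
      (forall s, p s -> l (f s) = 0) -> l (f b) != 0 ->
      cf_eval l x = l (f a) / l (f b).
Proof.
move=> pp; have [q [qp pq]] := f_surj pp.
have [E [k kq]] := prime_field qp.
have [t [u [qu tu]]] := cf_local x qp.
have ku : k u != 0 by apply/eqP => /kq.
have T1 : (1 : T) != 0.
  by apply/eqP => T10; have := oner_neq0 E; rewrite -(rmorph1 k) T10 rmorph0 eqxx.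
have S1 : (1 : S) != 0.
  by apply: contra_neq T1 => S10; rewrite -(rmorph1 f) S10 rmorph0.
pose Snz : comNzRingType := HB.pack (falg_ring S : Type)
  (GRing.ComPzRing.class (falg_ring S)) (GRing.PzSemiRing_isNonZero.Build S S1).
pose Tnz : comNzRingType := HB.pack (falg_ring T : Type)
  (GRing.ComPzRing.class (falg_ring T)) (GRing.PzSemiRing_isNonZero.Build T T1).
have [s gen] := falg_hom_generated.
have charE : [pchar E] =i pred0 := char0_field_over (k \o falg_str T) R_char0.
have lq (L : fieldType) (l : {rmorphism T -> L}) :
    (forall c, k c = 0 -> l c = 0) -> forall c, q c -> l c = 0.
  by move=> kl c /kq /kl.
have [a [c [kc tc]]] :
    exists a c : S, k (f c) != 0 /\ k t * k (f c) = k u * k (f a).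
  apply: (@value_fractional Snz Tnz f s E k t u gen charE ku).
  move=> L l m lm lk mk lu mu.
  rewrite -(tu L l) //; last exact: lq.
  rewrite -(tu L m) //; last exact: lq.
  exact: (matching_fields match_x).
have [b [kb bP]] := @generic_extension _ Snz Tnz f s E k u erefl gen ku.
(* The common factor [b] encodes the nonvanishing of both [c] and [b] in one denominator. *)
exists (a * b), (c * b); split.
  by move=> /pq/kq/eqP; rewrite !rmorphM mulf_eq0 (negPf kc) (negPf kb).
move=> L l lp; rewrite !rmorphM mulf_eq0 negb_or => /andP [lc lb].
rewrite -mulf_div divff // mulr1.
have [|L' [i [m [mf mk mu]]]] := bP L (l \o f) _ lb.
  by move=> d kd /=; apply/lp/pq/kq.
apply: (fmorph_inj i); rewrite -cf_eval_comp.
rewrite (@matching_fields _ _ _ _ _ match_x _ _ m); last by move=> d; rewrite mf.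
rewrite (tu L' m) //; last exact: lq.
rewrite fmorph_div -!mf; apply/eqP.
have mc : m (f c) != 0 by rewrite mf fmorph_eq0.
rewrite eqr_div // -!rmorphM -subr_eq0 -rmorphB; apply/eqP/mk.
by rewrite rmorphB !rmorphM tc [k (f a) * _]mulrC subrr.
Qed.

Lemma ideal_adjoin (A : comPzRingType) (I : A -> Prop) (b : A) : is_ideal I ->
  exists J : A -> Prop, [/\ is_ideal J, forall z, I z -> J z, J b &
    forall (B : comPzRingType) (h : {rmorphism A -> B}),
      (forall z, I z -> h z = 0) -> h b = 0 -> forall z, J z -> h z = 0].
Proof.
move=> idI; exists (fun z => exists i r, I i /\ z = i + r * b); split.
- split; first by exists 0, 0; rewrite mul0r addr0; split=> //; exact: pideal0.
    move=> _ _ [i [r [Ii ->]]] [j [s [Ij ->]]]; exists (i + j), (r + s).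
    by split; [exact: pidealD | rewrite mulrDl addrACA].
  move=> a _ [i [r [Ii ->]]]; exists (a * i), (a * r).
  by split; [exact: pidealMr | rewrite mulrDr mulrA].
- by move=> z Iz; exists z, 0; rewrite mul0r addr0.
- by exists 0, 1; rewrite mul1r add0r; split=> //; exact: pideal0.
move=> B h hI hb _ [i [r [/hI hi ->]]].
by rewrite rmorphD rmorphM hi hb mulr0 addr0.
Qed.

Lemma glue : acc S -> exists y : cfun S,
  forall (L : fieldType) (l : {rmorphism T -> L}), cf_eval l x = cf_eval (l \o f) y.
Proof.
move=> accS.
pose Q (I : S -> Prop) := exists y : cfun S,
  forall (L : fieldType) (l : {rmorphism T -> L}),
    (forall s, I s -> l (f s) = 0) -> cf_eval l x = cf_eval (l \o f) y.
suff [y yP] : Q (fun s => s = 0).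
  by exists y => L l; apply: yP => s ->; rewrite !rmorph0.
apply: (noetherian_induction accS); last first.
  by split=> // [_ _ -> ->|a _ ->]; rewrite ?addr0 ?mulr0.
move=> I idI IH.
have step b : ~ I b -> exists y : cfun S,
    forall (L : fieldType) (l : {rmorphism T -> L}),
      (forall s, I s -> l (f s) = 0) -> l (f b) = 0 ->
      cf_eval l x = cf_eval (l \o f) y.
  move=> Ib; have [J [idJ IJ Jb Jker]] := ideal_adjoin b idI.
  have [|y yP] := IH J idJ IJ; first by exists b.
  by exists y => L l lI lb; apply: yP; apply: (Jker L (l \o f)).
(* The function b b^-1 is the indicator of D(b), because 0^-1 = 0. *)
have ind b : exists e : cfun S, forall (L : fieldType) (l : {rmorphism T -> L}),
    (l (f b) = 0 -> cf_eval (l \o f) e = 0) /\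
    (l (f b) != 0 -> cf_eval (l \o f) e = 1).
  exists (cf_const S b * cf_inv (cf_const S b)) => L l.
  rewrite rmorphM /= cf_eval_inv cf_eval_const /=.
  by split=> [->|lb]; [rewrite mul0r | rewrite mulfV].
have [pI|npI] := EM (is_prime I).
  have [a [b [Ib abP]]] := local_value pI.
  have [[y yP] [e eP]] := (step b Ib, ind b).
  exists (e * (cf_const S a * cf_inv (cf_const S b)) + (1 - e) * y).
  move=> L l lI; have [e0 e1] := eP L l.
  rewrite rmorphD !(rmorphM (cf_eval _)) rmorphB rmorph1.
  rewrite cf_eval_inv !cf_eval_const /=.
  have [lb|lb] := eqVneq (l (f b)) 0.
    by rewrite e0 // mul0r add0r subr0 mul1r; exact: yP.
  by rewrite e1 // subrr mul0r addr0 mul1r; exact: abP.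
have [I1|I1] := EM (I 1).
  exists 0 => L l lI; have /eqP := lI 1 I1.
  by rewrite !rmorph1 oner_eq0.
(* V(I) is the union of V(I + (c)) and V(I + (d)); the first solution is used where [c] vanishes and
   the second elsewhere. *)
have [c [d [Icd Ic Id]]] : exists c d, [/\ I (c * d), ~ I c & ~ I d].
  apply: contrapT => nex; apply: npI; split=> // c d Icd.
  by apply: contrapT => /not_orP [Ic Id]; apply: nex; exists c, d.
have [[y yP] [z zP] [e eP]] := And3 (step c Ic) (step d Id) (ind c).
exists ((1 - e) * y + e * z) => L l lI; have [e0 e1] := eP L l.
rewrite rmorphD !(rmorphM (cf_eval _)) rmorphB rmorph1.
have [lc|lc] := eqVneq (l (f c)) 0.
  by rewrite e0 // mul0r addr0 subr0 mul1r; exact: yP.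
rewrite e1 // subrr mul0r add0r mul1r; apply: zP => //.
have /eqP := lI _ Icd; rewrite !rmorphM mulf_eq0 (negPf lc) /=.
by move/eqP.
Qed.

End Gluing.

(** Let [p] be the kernel of a morphism to a field. On V(p) the difference is a fraction a/b
    wherever [b] is nonzero; it vanishes at a prime of [T] over [p], so [a] lies in [p]. *)
Lemma cf_map_injective (S T : comPzRingType) (f : {rmorphism S -> T}) :
  Spec_surjective f -> injective (cf_map f).
Proof.
move=> fs y z yz; apply: cf_ext => L h; apply/eqP; rewrite -subr_eq0 -rmorphB.
have pp := kernel_prime h; have [q [qp pq]] := fs _ pp.
have [E [k kq]] := prime_field qp.
have [a [b [hb abP]]] := cf_local (y - z) pp.
have hb0 : h b != 0 by exact/eqP.
rewrite (abP L h) // mulf_eq0; apply/orP; left; apply/eqP/pq/kq/eqP.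
have kb : k (f b) != 0 by apply/eqP => /kq/pq.
have := abP E (k \o f) _ kb; rewrite -cf_eval_map rmorphB yz subrr rmorph0.
move=> H; have /esym/eqP := H (fun s hs => (kq _).2 ((pq s).1 hs)).
by rewrite mulf_eq0 invr_eq0 (negPf kb) orbF.
Qed.

Lemma cf_surj_sheaf (R : comPzRingType) :
  noetherian R -> contains_char0_field R ->
  is_sheaf (@surj_cov R) (cf_presheaf R).
Proof.
move=> nR char0 S T f fs x match_x.
have [y yP] := glue char0 fs match_x (falg_acc nR).
have yx : cf_map f y = x by apply: cf_ext => L l; rewrite cf_eval_map yP.
by exists y; split=> // z zx; apply: (cf_map_injective fs); rewrite yx.
Qed.

(** * Comparison of the two sheafifications *)

Lemma surj_cons_sheaf (R : comPzRingType) (F : presheaf R) :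
  is_sheaf (@surj_cov R) F -> is_sheaf (@cons_cov R) F.
Proof. by move=> sF S T f /cons_surj_cov; exact: sF. Qed.

Lemma phom_id_subproof (R : comPzRingType) (F : presheaf R) (S T : falg R)
  (f : falg_hom S T) (x : F S) :
  (idfun : {rmorphism F T -> F T}) (res F f x) =
  res F f ((idfun : {rmorphism F S -> F S}) x).
Proof. by []. Qed.

Definition phom_id (R : comPzRingType) (F : presheaf R) : presheaf_hom F F :=
  PresheafHom (@phom_id_subproof R F).

Lemma phom_comp_subproof (R : comPzRingType) (F G H : presheaf R)
  (k : presheaf_hom G H) (h : presheaf_hom F G) (S T : falg R)
  (f : falg_hom S T) (x : F S) :
  (k T \o h T : {rmorphism F T -> H T}) (res F f x) =
  res H f ((k S \o h S : {rmorphism F S -> H S}) x).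
Proof. by rewrite /= !phom_nat. Qed.

Definition phom_comp (R : comPzRingType) (F G H : presheaf R)
  (k : presheaf_hom G H) (h : presheaf_hom F G) : presheaf_hom F H :=
  PresheafHom (phom_comp_subproof k h).

(** The coverage is arbitrary so as to serve both topologies. The universal property of [O] gives
    [h] and [cf_to] gives [k]; uniqueness of morphisms under the structure presheaf, on each side,
    makes them inverse. *)
Lemma cf_sheafification (R : comPzRingType) (cov : coverage R) (O : presheaf R)
    (eta : presheaf_hom (structure_presheaf R) O) :
  is_sheafification cov eta -> is_sheaf cov (cf_presheaf R) ->
  is_sheaf (@cons_cov R) O ->
  exists (h : presheaf_hom O (cf_presheaf R)) (k : presheaf_hom (cf_presheaf R) O),
    [/\ factors_through eta (cf_eta R) h, factors_through (cf_eta R) eta k,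
        forall S, cancel (h S) (k S) & forall S, cancel (k S) (h S)].
Proof.
move=> [Osh Ouniv] cfsh Ocons; have [h [hE _]] := Ouniv _ (cf_eta R) cfsh.
pose k := cf_to eta Ocons.
have kE : factors_through (cf_eta R) eta k := cf_toP eta Ocons.
exists h, k; split=> // S.
  have [i [_ iU]] := Ouniv _ eta Osh => y.
  have := iU (phom_comp k h) _ S y; rewrite /= => ->; last first.
    by move=> U s /=; rewrite hE kE.
  by rewrite -(iU (phom_id O)) //.
apply: (@cf_phom_unique _ _ (phom_comp h k) (phom_id _)) => U s /=.
by rewrite [k U _]kE [h U _]hE.
Qed.

Theorem theorem3p8p2 (R : comPzRingType)
  (R_noeth : noetherian R)
  (R_dim : finite_dimension R)
  (R_char0 : contains_char0_field R)
  (O_surj O_cons : presheaf R)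
  (eta_surj : presheaf_hom (structure_presheaf R) O_surj)
  (eta_cons : presheaf_hom (structure_presheaf R) O_cons)
  (O_surjP : is_sheafification (@surj_cov R) eta_surj)
  (O_consP : is_sheafification (@cons_cov R) eta_cons) :
  exists phi : presheaf_hom O_cons O_surj,
    unique_factorization eta_cons eta_surj phi /\
    bijective (phi (falg_base R)).
Proof.
have Fsurj := cf_surj_sheaf R_noeth R_char0.
have Scons := surj_cons_sheaf O_surjP.1.
have [hs [ks [hsE ksE hsK ksK]]] := cf_sheafification O_surjP Fsurj Scons.
have [hc [kc [hcE kcE hcK kcK]]] :=
  cf_sheafification O_consP (surj_cons_sheaf Fsurj) O_consP.1.
have [phi phiU] := O_consP.2 _ eta_surj Scons; exists phi; split=> //.
(* By uniqueness [phi] is the composite of the two isomorphisms through constructible functions. *)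
have phiE S y : phi S y = ks S (hc S y).
  rewrite -(phiU.2 (phom_comp ks hc)) // => U s /=.
  by rewrite hcE ksE.
exists (kc (falg_base R) \o hs (falg_base R)) => y /=.
  by rewrite phiE ksK hcK.
by rewrite phiE kcK hsK.
Qed.
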